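(* Let $\mathcal{G}$ be a compact metric graph with total length $|\mathcal{G}|=L>0$ and $E$ edges. Then $$\frac{2E-1}{4E^2}\,L \le \rho(\mathcal{G}) \le \frac{L}{3}.$$ Equality holds in the lower bound if and only if $\mathcal{G}$ is an equilateral flower graph. Equality holds in the upper bound if and only if $\mathcal{G}$ is a path graph (i.e. an interval). If $\mathcal{G}$ is moreover doubly connected, then $\rho(\mathcal{G}) \le L/4$, with equality if and only if $\mathcal{G}$ is a loop.
   Context: A compact metric graph $\mathcal{G}$ is a connected graph with finitely many vertices and finitely many edges. Loops and multiple edges are allowed. Each edge $e$ is identified with an interval $(0,\ell_e)$ with $\ell_e>0$. The graph carries the shortest-path distance $\operatorname{dist}$ and Lebesgue measure on the edges, and its total length is $|\mathcal{G}|=\sum_e\ell_e$. The mean distance is $\rho(\mathcal{G})=\frac{1}{|\mathcal{G}|^2}\int_{\mathcal{G}}\int_{\mathcal{G}}\operatorname{dist}(x,y)\,\mathrm{d}y\,\mathrm{d}x$. A flower graph on $m$ edges has exactly one vertex, with all $m$ edges being loops attached at both ends to that vertex. It is equilateral if all edges have the same length. A path graph is a metric graph isometric to a compact interval. A loop is a metric graph isometric to a circle. $\mathcal{G}$ is doubly connected if for any $x,y\in\mathcal{G}$ there exist two edgewise disjoint paths from $x$ to $y$; equivalently, no edge is a bridge. *)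

(* Defs.v *)
From HB Require Import structures.
From mathcomp Require Import all_boot all_order all_algebra.
From mathcomp Require Import all_classical all_reals all_analysis.

Set Implicit Arguments.
Unset Strict Implicit.
Unset Printing Implicit Defensive.

Import Order.TTheory GRing.Theory Num.Theory.
Import numFieldNormedType.Exports.

Local Open Scope classical_set_scope.
Local Open Scope ring_scope.

(* Each edge carries an arbitrary orientation, used only to parametrize it by
   ]0, len e[ from src e to tgt e. Loops (src e = tgt e) and multiple edges are
   allowed. *)
Record metricGraph (R : realType) := MetricGraph {
  vert : finType;
  edge : finType;
  src : edge -> vert;
  tgt : edge -> vert;
  len : edge -> R;
  len_gt0 : forall e, 0 < len e;
  graph_connected : forall u v : vert,
    connect (fun a b => [exists e, ((src e == a) && (tgt e == b))
                                || ((src e == b) && (tgt e == a))]) u v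
}.

Section MetricGraph.
Context {R : realType} (G : metricGraph R).

(* A point is a vertex, inl v, or an interior point of an edge, inr (e, s) with
   0 < s < len e; the condition on s is imposed by the set [points]. *)
Definition rawpoint : Type := (vert G + edge G * R)%type.

Definition points : set rawpoint :=
  [set x | match x with inl _ => True | inr (e, s) => 0 < s < len e end].

(* The point with coordinate s in the closed interval [0, len e], whose ends
   are glued to the vertices src e and tgt e. *)
Definition pt (e : edge G) (s : R) : rawpoint :=
  if s <= 0 then inl (src e)
  else if len e <= s then inl (tgt e)
  else inr (e, s).

Definition total_length : R := \sum_(e : edge G) len e.

(* A path is a finite concatenation of segments, each running inside one closed
   edge from coordinate seg_from to coordinate seg_to, in either direction. *)
Definition segment : Type := (edge G * R * R)%type.
Definition seg_edge (g : segment) : edge G := g.1.1.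
Definition seg_from (g : segment) : R := g.1.2.
Definition seg_to (g : segment) : R := g.2.

Definition seg_wf (g : segment) : Prop :=
  0 <= seg_from g <= len (seg_edge g) /\ 0 <= seg_to g <= len (seg_edge g).

Fixpoint is_path (x : rawpoint) (p : seq segment) (y : rawpoint) : Prop :=
  match p with
  | [::] => x = y
  | g :: p' => [/\ seg_wf g, x = pt (seg_edge g) (seg_from g)
                 & is_path (pt (seg_edge g) (seg_to g)) p' y]
  end.

Definition path_length (p : seq segment) : R :=
  \sum_(g <- p) `|seg_to g - seg_from g|.

Definition dist (x y : rawpoint) : R :=
  inf [set path_length p | p in [set p | is_path x p y]].

Definition graph_integral (f : rawpoint -> R) : R :=
  \sum_(e : edge G) Rintegral lebesgue_measure `]0, len e[ (fun s => f (pt e s)).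

Definition mean_distance : R :=
  (total_length ^+ 2)^-1 *
  graph_integral (fun x => graph_integral (fun y => dist x y)).

Definition flower_graph : Prop :=
  #|vert G| = 1%N /\ forall e : edge G, src e = tgt e.

Definition equilateral : Prop := forall e f : edge G, len e = len f.

Definition isometric_to (T : Type) (A : set T) (d : T -> T -> R) : Prop :=
  exists f : rawpoint -> T, set_bij points A f /\
    forall x y, points x -> points y -> d (f x) (f y) = dist x y.

Definition path_graph : Prop :=
  exists a b : R, a <= b /\ isometric_to `[a, b] (fun s t => `|s - t|).

(* The circle of circumference c is R/cZ with its arc-length distance, each
   class being represented by its element in [0, c[. *)
Definition circle_dist (c s t : R) : R := Num.min `|s - t| (c - `|s - t|).

Definition loop_graph : Prop :=
  exists c : R, 0 < c /\ isometric_to `[0, c[ (circle_dist c).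

Definition seg_interior (g : segment) : set R :=
  [set r | Num.min (seg_from g) (seg_to g) < r
             < Num.max (seg_from g) (seg_to g)].

(* Two paths are edgewise disjoint if they have no piece of edge of positive
   length in common. As the end points x, y below may be interior to edges,
   "edge" has to be understood after turning x and y into vertices. *)
Definition edgewise_disjoint (p q : seq segment) : Prop :=
  forall g h : segment, g \in p -> h \in q -> seg_edge g = seg_edge h ->
    seg_interior g `&` seg_interior h = set0.

Definition doubly_connected : Prop :=
  forall x y, points x -> points y ->
    exists p q, [/\ is_path x p y, is_path x q y & edgewise_disjoint p q].

End MetricGraph.

(* Main.v *)
(** The lower bound holds pointwise: two points of one edge of length l are at
    least as far apart as on a circle of length l, and two points of different
    edges are at least as far apart as the sum of their distances to the ends of
    their edges. Integrating gives W >= L (sum l^2) / 2 - (sum l^3) / 4 for the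
    double integral W of the distance, and the tangent line at l = L / E bounds
    this from below.

    For W <= L^3 / 3, build the graph by attaching one edge e at a time to a
    connected set H of edges. The distance from e into H goes through the point
    of attachment v, and D_H(v) <= |H|^2 / 2, where D is the integral of the
    distance to a point; so attaching e of length l adds at most
    |H|^2 l + |H| l^2 + l^3 / 3.

    The other statements use the coarea formula: the integral of psi(dist x y)
    over y is the integral of psi(r) N(r) over r, where N(r) is the number of
    points at distance r from x. If N >= k up to the eccentricity M of x, then
    D(x) <= L M - k M^2 / 2, with equality only if N <= k at all levels. Here
    k = 1 always, and k = 2 in a doubly connected graph, where two disjoint paths
    to a farthest point both cross each level. In the first equality case some x
    has D(x) = L^2 / 2, which forces M = L and N = 1, so the distance to x is an
    isometry onto an interval. In the second one every x has D(x) = L^2 / 4, hence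
    an antipode at distance L / 2 such that every point is between the two; as
    N <= 2 this is a circle. *)
Require Import Defs.
From HB Require Import structures.
From mathcomp Require Import all_boot all_order all_algebra.
From mathcomp Require Import all_classical all_reals all_analysis.
From mathcomp Require Import ring lra.

Set Implicit Arguments.
Unset Strict Implicit.
Unset Printing Implicit Defensive.

Import Order.TTheory GRing.Theory Num.Theory.
Import numFieldNormedType.Exports.

Local Open Scope classical_set_scope.
Local Open Scope ring_scope.

(** * Integrals over intervals *)

Section Integral.
Context {R : realType}.
Implicit Types (a b c : R) (f g : R -> R).

Definition itg a b f : R := Rintegral lebesgue_measure `]a, b[ f.

Lemma integrable_continuous_subset a b f (A : set R) : continuous f ->
  measurable A -> A `<=` `[a, b] -> lebesgue_measure.-integrable A (EFin \o f).
Proof.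
move=> cf mA Aab; apply: (@integrableS _ _ _ lebesgue_measure `[a, b]) => //.
apply: continuous_compact_integrable; first exact: segment_compact.
exact: continuous_subspaceT.
Qed.

Lemma integrable_continuous a b f : continuous f ->
  lebesgue_measure.-integrable `]a, b[ (EFin \o f).
Proof.
by move=> cf; apply: (@integrable_continuous_subset a b) => //; exact: subset_itvW.
Qed.

Lemma itg_ge a b f : b <= a -> itg a b f = 0.
Proof. by move=> ba; rewrite /itg set_itv_ge ?Rintegral_set0// bnd_simp -leNgt. Qed.

Lemma itgD a b f g : continuous f -> continuous g ->
  itg a b (fun x => f x + g x) = itg a b f + itg a b g.
Proof. by move=> cf cg; rewrite /itg RintegralD//; apply: integrable_continuous. Qed.

Lemma itgZ a b k f : continuous f ->
  itg a b (fun x => k * f x) = k * itg a b f.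
Proof. by move=> cf; rewrite /itg RintegralZl//; apply: integrable_continuous. Qed.

Lemma itg_cst a b k : a <= b -> itg a b (fun=> k) = k * (b - a).
Proof.
move=> ab; rewrite /itg Rintegral_cst//= lebesgue_measure_itv/= lte_fin.
by case: ltgtP ab => // -> _; rewrite subrr.
Qed.

Lemma le_itg a b f g : continuous f -> continuous g ->
  (forall x, a < x < b -> f x <= g x) -> itg a b f <= itg a b g.
Proof.
move=> cf cg fg; by apply: le_Rintegral => //; exact: integrable_continuous.
Qed.

Lemma eq_itg a b f g :
  (forall x, a < x < b -> f x = g x) -> itg a b f = itg a b g.
Proof.
move=> fg; apply: eq_Rintegral => x.
by rewrite inE/= in_itv/= => /fg.
Qed.

Lemma itg_split a c b f : continuous f -> a <= c <= b ->
  itg a b f = itg a c f + itg c b f.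
Proof.
move=> cf /andP[ac cb].
case: (ltgtP a c) ac => // [ac|->] _; last first.
  by rewrite [X in _ = X + _]itg_ge ?add0r.
case: (ltgtP c b) cb => // [cb|->] _; last first.
  by rewrite [X in _ = _ + X]itg_ge ?addr0.
rewrite /itg -(@Rintegral_itvB _ f (BRight a) (BLeft b) c).
- have -> := Rintegral_itv_bndo_bndc (@integrable_continuous a c f cf).
  by rewrite addrCA subrr addr0.
- exact: integrable_continuous.
- by rewrite bnd_simp ltW.
- by rewrite bnd_simp.
Qed.

Lemma itg_FTC a b f F : a <= b -> continuous f ->
  (forall x : R, is_derive x (1 : R) F (f x)) -> itg a b f = F b - F a.
Proof.
case: (ltgtP a b) => // [ab|->] _ cf dF; last by rewrite itg_ge// subrr.
have cF : continuous F.
  by move=> x; apply/differentiable_continuous/derivable1_diffP; case: (dF x).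
rewrite /itg Rintegral_itv_bndo_bndc; last exact: integrable_continuous.
rewrite Rintegral_itv_obnd_cbnd; last first.
  apply: (@integrable_continuous_subset a b) => // y /=.
  by rewrite !in_itv/= => /andP[/ltW -> ->].
rewrite /Rintegral (continuous_FTC2 ab _ (F := F))//.
- exact: continuous_subspaceT.
- split.
  + by move=> x _; case: (dF x).
  + exact/cvg_at_right_filter/cF.
  + exact/cvg_at_left_filter/cF.
- by move=> x _; rewrite derive1E; case: (dF x).
Qed.

Lemma continuous_oppr f : continuous f -> continuous (fun x => - f x).
Proof. by move=> cf x; apply: continuousN; apply: cf. Qed.

Lemma continuous_addr f g : continuous f -> continuous g -> continuous (fun x => f x + g x).
Proof. by move=> cf cg x; apply: continuousD; [apply: cf|apply: cg]. Qed.

Lemma itgB a b f g : continuous f -> continuous g ->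
  itg a b (fun x => f x - g x) = itg a b f - itg a b g.
Proof.
move=> cf cg; rewrite itgD//; last exact: continuous_oppr.
by congr (_ + _); rewrite -mulN1r -itgZ//; apply: eq_itg => x _; rewrite mulN1r.
Qed.

Lemma itg_eq_le a b f g : continuous f -> continuous g ->
  (forall x, a < x < b -> f x <= g x) -> itg a b g <= itg a b f ->
  forall x, a < x < b -> f x = g x.
Proof.
move=> cf cg fg gf x /andP[ax xb]; apply/eqP; rewrite eq_le fg ?ax//=.
rewrite leNgt; apply/negP => fgx.
pose h y := g y - f y; have ch : continuous h by apply: continuous_addr => //; exact: continuous_oppr.
have hx : 0 < h x by rewrite subr_gt0.
have hge y : a < y < b -> 0 <= h y by move=> /fg; rewrite subr_ge0.
have /cvgrPdist_lt/(_ (h x / 2)) : h y @[y --> x] --> h x := ch x.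
rewrite divr_gt0// => /(_ isT)/nbhs_ballP[e/= e0 He].
pose u := Num.max ((a + x) / 2) (x - e / 2); pose v := Num.min ((b + x) / 2) (x + e / 2).
have [au ux] : a < u /\ u < x.
  by rewrite /u; case: (leP ((a + x) / 2)) => ?; split; lra.
have [xv vb] : x < v /\ v < b.
  by rewrite /v; case: (leP ((b + x) / 2)) => ?; split; lra.
have uv y : u < y < v -> h x / 2 <= h y.
  move=> /andP[uy yv].
  have : ball x e y.
    rewrite /ball/= ltr_norml; move: uy yv; rewrite /u /v.
    by case: (leP ((a + x) / 2)); case: (leP ((b + x) / 2)) => *; apply/andP; split; lra.
  by move=> /He; rewrite ltr_norml => /andP[]; lra.
have : 0 < itg a b h.
  rewrite (@itg_split a u)//; last by rewrite (ltW au) (ltW (lt_trans ux (lt_trans xv vb))).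
  rewrite (@itg_split u v b)//; last by rewrite (ltW vb) (ltW (lt_trans ux xv)).
  rewrite ltr_wpDl//.
    rewrite -[0](@mul0r _ (u - a)) -(itg_cst _ (ltW au)); apply: le_itg => //.
      exact: cst_continuous.
    by move=> y /andP[? ?]; apply: hge; apply/andP; split; lra.
  rewrite ltr_wpDr//.
    rewrite -[0](@mul0r _ (b - v)) -(itg_cst _ (ltW vb)); apply: le_itg => //.
      exact: cst_continuous.
    by move=> y /andP[? ?]; apply: hge; apply/andP; split; lra.
  apply: (@lt_le_trans _ _ (h x / 2 * (v - u))); first by rewrite mulr_gt0//; lra.
  rewrite -itg_cst//; last lra.
  by apply: le_itg => //; exact: cst_continuous.
by rewrite itgB//; lra.
Qed.

Lemma itg_id a b : a <= b -> itg a b id = (b ^+ 2 - a ^+ 2) / 2.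
Proof.
move=> ab.
have dF (x : R) : is_derive x (1 : R) (fun y : R => y ^+ 2 / 2 : R) x.
  by apply: is_derive_eq; rewrite /GRing.scale/=; field.
rewrite (@itg_FTC _ _ _ (fun x => x ^+ 2 / 2))//; first by ring.
by move=> x; exact: cvg_id.
Qed.

Lemma itg_sqr a b : a <= b -> itg a b (fun x => x ^+ 2) = (b ^+ 3 - a ^+ 3) / 3.
Proof.
move=> ab.
have dF (x : R) : is_derive x (1 : R) (fun y : R => y ^+ 3 / 3 : R) (x ^+ 2).
  by apply: is_derive_eq; rewrite /GRing.scale/=; field.
rewrite (@itg_FTC _ _ _ (fun x => x ^+ 3 / 3))//; first by ring.
exact: exprn_continuous.
Qed.

End Integral.

Section IntervalFamily.
Context {R : realType}.
Implicit Types (A B C : seq (R * R)) (u v r y : R) (F : R -> R).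

Definition inside r (i : R * R) : bool := i.1 < r < i.2.

Definition increments F C : R := \sum_(i <- C) (F i.2 - F i.1).

Let clamp u v r := Num.max u (Num.min r v).

Let clamped F C u v := \sum_(i <- C) (F (clamp u v i.2) - F (clamp u v i.1)).

Let clamped_split F C u y v : u <= y <= v ->
  clamped F C u v = clamped F C u y + clamped F C y v.
Proof.
move=> uyv; rewrite -big_split/=; apply: eq_bigr => i _.
have H r : F (clamp u v r) = F (clamp u y r) + F (clamp y v r) - F y.
  rewrite /clamp; case/andP: uyv => uy yv.
  case: (leP r v) => rv; case: (leP r y) => ry.
  - by ring.
  - by rewrite (max_idPr uy) (max_idPr (ltW (le_lt_trans uy ry))); ring.
  - by move: (lt_le_trans rv ry); rewrite ltNge yv.
  - by rewrite (max_idPr uy) (max_idPr yv) (max_idPr (le_trans uy yv)); ring.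
by rewrite !H; ring.
Qed.

Let clamped_nobreak F C u v : u < v ->
  (forall i, i \in C -> [/\ i.1 <= i.2, ~~ (u < i.1 < v) & ~~ (u < i.2 < v)]) ->
  clamped F C u v = (count (inside ((u + v) / 2)) C)%:R * (F v - F u).
Proof.
move=> uv; have [um mv] : u < (u + v) / 2 /\ (u + v) / 2 < v by lra.
move: ((u + v) / 2) um mv => m um mv.
elim: C => [|i C IH] HC; first by rewrite /clamped big_nil mul0r.
rewrite /clamped big_cons -/(clamped F C u v) IH; last first.
  by move=> j jC; apply: HC; rewrite inE jC orbT.
rewrite /= natrD mulrDl; congr (_ + _).
have uv' := ltW uv.
have lo r : r <= u -> clamp u v r = u.
  by move=> ru; rewrite /clamp (min_idPl (le_trans ru uv')) (max_idPl ru).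
have hi r : v <= r -> clamp u v r = v.
  by move=> vr; rewrite /clamp (min_idPr vr) (max_idPr uv').
have [i12] := HC i (mem_head _ _); rewrite !negb_and -!leNgt /inside.
move=> /orP[] H1 /orP[] H2.
- by rewrite (ltNge m) (le_trans H2 (ltW um)) andbF mul0r (lo _ H1) (lo _ H2) subrr.
- by rewrite (le_lt_trans H1 um) (lt_le_trans mv H2) mul1r (lo _ H1) (hi _ H2).
- by move: (lt_le_trans (lt_le_trans uv H1) (le_trans i12 H2)); rewrite ltxx.
- by rewrite ltNge (le_trans (ltW mv) H1) mul0r (hi _ H1) (hi _ H2) subrr.
Qed.

Lemma le_increments F A B (X : seq R) lo hi : lo <= hi ->
  (forall x y, lo <= x -> x <= y -> y <= hi -> F x <= F y) ->
  (forall i, i \in A ++ B -> [/\ lo <= i.1, i.1 <= i.2 & i.2 <= hi]) ->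
  (forall r, lo < r < hi -> r \notin X ->
    (count (inside r) B <= count (inside r) A)%N) ->
  increments F B <= increments F A.
Proof.
move=> lohi mF rng cnt.
have cl C : {subset C <= A ++ B} -> increments F C = clamped F C lo hi.
  move=> CAB; apply: eq_big_seq => i /CAB/rng[i1 i12 i2].
  rewrite /clamp (min_idPl i2) (min_idPl (le_trans i12 i2)) (max_idPr i1).
  by rewrite (max_idPr (le_trans i1 i12)).
rewrite !cl; [|by move=> i iA; rewrite mem_cat iA| by move=> i iB; rewrite mem_cat iB orbT].
pose brk := X ++ map fst (A ++ B) ++ map snd (A ++ B).
suff: forall (Y : seq R) u v, lo <= u -> u <= v -> v <= hi ->
    (forall y, y \in brk -> u < y < v -> y \in Y) -> clamped F B u v <= clamped F A u v.
  by apply => // y ybrk _; exact: ybrk.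
elim=> [|y Y IH] u v lou uv vhi HY.
  move: uv; rewrite le_eqVlt => /predU1P[<-|uv].
    have H C : clamped F C u u = 0.
      apply: big1 => i _; suff H r : clamp u u r = u by rewrite !H subrr.
      by rewrite /clamp; case: (leP r u) => [/max_idPl|] //; rewrite maxxx.
    by rewrite !H.
  have nobrk y : y \in brk -> ~~ (u < y < v).
    by move=> /HY yN; apply/negP => /yN; rewrite in_nil.
  have HC C : {subset C <= A ++ B} -> forall i, i \in C ->
      [/\ i.1 <= i.2, ~~ (u < i.1 < v) & ~~ (u < i.2 < v)].
    move=> CAB i /CAB iAB; have [_ ? _] := rng i iAB; split => //; apply: nobrk.
      by rewrite !mem_cat map_f ?orbT.
    by rewrite !mem_cat (map_f snd) ?orbT.
  rewrite !clamped_nobreak//; [|by apply: HC => i iA; rewrite mem_cat iA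
    |by apply: HC => i iB; rewrite mem_cat iB orbT].
  rewrite ler_wpM2r ?subr_ge0 ?mF//; [exact: ltW|].
  rewrite ler_nat; apply: cnt; first by apply/andP; split; lra.
  have muv : u < (u + v) / 2 < v by apply/andP; split; lra.
  by apply: contraL muv => mX; apply: nobrk; rewrite mem_cat mX.
case: (boolP (u < y < v)) => [/andP[uy yv]|yuv].
  have uyv : u <= y <= v by rewrite !ltW.
  rewrite !(clamped_split _ _ uyv); apply: lerD; apply: IH => //; try exact: ltW.
  - exact: le_trans (ltW yv) vhi.
  - move=> z zb /andP[uz zy]; have := HY z zb; rewrite uz (lt_trans zy yv) => /(_ isT).
    by rewrite inE (lt_eqF zy).
  - exact: le_trans lou (ltW uy).
  - move=> z zb /andP[yz zv]; have := HY z zb; rewrite zv (lt_trans uy yz) => /(_ isT).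
    by rewrite inE (gt_eqF yz).
apply: IH => // z zb zuv; have := HY z zb zuv; rewrite inE => /predU1P[zy|//].
by rewrite -zy zuv in yuv.
Qed.

End IntervalFamily.

(** * The path metric *)

Section Metric.
Context {R : realType} {G : metricGraph R}.
Implicit Types (x y z : rawpoint G) (e f : edge G) (p q : seq (segment G)).
Implicit Types (s t r : R) (u v w : vert G).

Lemma pt_src e s : s <= 0 -> pt e s = inl (src e).
Proof. by rewrite /pt => ->. Qed.

Lemma pt_tgt e s : len e <= s -> pt e s = inl (tgt e).
Proof. by move=> h; rewrite /pt leNgt (lt_le_trans (len_gt0 e) h)/= h. Qed.

Lemma pt_in e s : 0 < s < len e -> pt e s = inr (e, s).
Proof. by move=> /andP[s0 sl]; rewrite /pt !leNgt s0 sl. Qed.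

Variant pt_spec e s : rawpoint G -> Type :=
| PtSrc of s <= 0 : pt_spec e s (inl (src e))
| PtTgt of len e <= s : pt_spec e s (inl (tgt e))
| PtIn of 0 < s & s < len e : pt_spec e s (inr (e, s)).

Lemma ptP e s : pt_spec e s (pt e s).
Proof.
rewrite /pt; case: (leP s 0) => [h|h]; first by constructor.
by case: (leP (len e) s) => h'; constructor.
Qed.

Lemma points_pt e s : points (pt e s).
Proof. by case: ptP => //= ? ?; apply/andP. Qed.

Definition clamp e s := Num.max 0 (Num.min s (len e)).

Lemma clamp_itv e s : 0 <= clamp e s <= len e.
Proof.
have l0 := ltW (len_gt0 e); rewrite /clamp le_max lexx/=.
by rewrite ge_max l0 ge_min lexx orbT.
Qed.

Lemma pt_clamp e s : pt e (clamp e s) = pt e s.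
Proof.
rewrite /clamp; have l0 := len_gt0 e; case: (leP s (len e)) => [sl|sl].
  by case: (leP 0 s) => // h; rewrite !pt_src// ltW.
by rewrite (max_idPr (ltW l0)) !pt_tgt// ltW.
Qed.

Lemma clamp_lip e s t : `|clamp e s - clamp e t| <= `|s - t|.
Proof.
wlog st : s t / s <= t.
  by move=> H; case: (leP s t) => [/H//|/ltW/H]; rewrite distrC (distrC t).
have l0 := ltW (len_gt0 e).
rewrite (ler0_norm (_ : s - t <= 0)) ?subr_le0// ler_norml /clamp.
case: (leP s (len e)) => hs; case: (leP t (len e)) => ht; rewrite ?(max_idPr l0).
- by case: (leP 0 s) => s0; case: (leP 0 t) => t0; apply/andP; split; lra.
- by case: (leP 0 s) => s0; apply/andP; split; lra.
- by apply/andP; split; lra.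
- by apply/andP; split; lra.
Qed.

Lemma path_length_ge0 p : 0 <= path_length p.
Proof. exact: sumr_ge0. Qed.

Lemma is_path_cat x y z p q : is_path x p y -> is_path y q z -> is_path x (p ++ q) z.
Proof.
elim: p x => [|g p IH] x /=; first by move=> ->.
by move=> [? ? /IH H] /H.
Qed.

Lemma path_length_cat p q : path_length (p ++ q) = path_length p + path_length q.
Proof. by rewrite /path_length big_cat. Qed.

Definition rev_seg (g : segment G) : segment G := (seg_edge g, seg_to g, seg_from g).

Lemma is_path_rev x y p : is_path x p y -> is_path y (rev (map rev_seg p)) x.
Proof.
elim: p x => [|g p IH] x /=; first by move=> ->.
move=> [[wf1 wf2] -> /IH H]; rewrite rev_cons -cats1.
by apply: is_path_cat H _; split.
Qed.

Lemma path_length_rev p : path_length (rev (map rev_seg p)) = path_length p.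
Proof.
rewrite /path_length (perm_big (map rev_seg p)) ?perm_rev//= big_map.
by apply: eq_bigr => g _; rewrite distrC.
Qed.

Lemma is_path_seg e s t : is_path (pt e s) [:: (e, clamp e s, clamp e t)] (pt e t).
Proof. by split; rewrite ?pt_clamp//; split; exact: clamp_itv. Qed.

Lemma path_vert u v : exists p, is_path (inl u : rawpoint G) p (inl v).
Proof.
have /connectP[c cp ->] := @graph_connected R G u v.
elim: c u cp => [|w c IH] u /=; first by exists [::].
move=> /andP[/existsP[e /orP[]/andP[/eqP <- /eqP <-]] /IH[p pp]].
- exists ((e, 0, len e) :: p); split.
  + by split; rewrite /seg_from/seg_to/= ?lexx ltW ?len_gt0.
  + by rewrite pt_src.
  + by rewrite pt_tgt.
- exists ((e, len e, 0) :: p); split.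
  + by split; rewrite /seg_from/seg_to/= ?lexx ltW ?len_gt0.
  + by rewrite pt_tgt.
  + by rewrite pt_src.
Qed.

Lemma path_to_vert x : points x -> exists u p, is_path x p (inl u).
Proof.
case: x => [u _|[e s] /= h]; first by exists u, [::].
exists (src e), [:: (e, clamp e s, clamp e 0)].
by have := is_path_seg e s 0; rewrite (pt_in h) [pt e 0]pt_src.
Qed.

Lemma path_exists x y : points x -> points y -> exists p, is_path x p y.
Proof.
move=> /path_to_vert[u [p xp]] /path_to_vert[v [q yq]].
have [c uv] := path_vert u v.
by exists (p ++ (c ++ rev (map rev_seg q)));
  apply: is_path_cat xp (is_path_cat uv (is_path_rev yq)).
Qed.

Lemma dist_le_path x y p : is_path x p y -> dist x y <= path_length p.
Proof.
move=> xp; apply: ge_inf; last by exists p.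
by exists 0 => _ [q _ <-]; exact: path_length_ge0.
Qed.

Lemma dist_approx x y : points x -> points y -> forall eps, 0 < eps ->
  exists2 p, is_path x p y & path_length p < dist x y + eps.
Proof.
move=> px py eps e0; have [p0 xp0] := path_exists px py.
have [|_ [p xp <-] pl] := @inf_adherent _ [set path_length p | p in [set p | is_path x p y]] _ e0.
  by split; [exists (path_length p0), p0 | exists 0 => _ [q _ <-]; exact: path_length_ge0].
by exists p.
Qed.

Lemma le_dist c x y : points x -> points y ->
  (forall p, is_path x p y -> c <= path_length p) -> c <= dist x y.
Proof.
move=> px py H; apply/ler_addgt0Pr => eps e0.
by have [p /H cp /ltW] := dist_approx px py e0; exact: le_trans.
Qed.

Lemma dist_ge0 x y : points x -> points y -> 0 <= dist x y.
Proof. by move=> px py; apply: le_dist => // p _; exact: path_length_ge0. Qed.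

Lemma dist_xx x : points x -> dist x x = 0.
Proof.
move=> px; apply/eqP; rewrite eq_le dist_ge0// andbT.
by apply: le_trans (@dist_le_path x x [::] erefl) _; rewrite /path_length big_nil.
Qed.

Lemma dist_sym x y : points x -> points y -> dist x y = dist y x.
Proof.
suff H (a b : rawpoint G) : points a -> points b -> dist a b <= dist b a.
  by move=> px py; apply/eqP; rewrite eq_le !H.
move=> pa pb; apply: (le_dist pb pa) => p /is_path_rev/dist_le_path.
by rewrite path_length_rev.
Qed.

Lemma dist_tri x y z : points x -> points y -> points z ->
  dist x z <= dist x y + dist y z.
Proof.
move=> px py pz; rewrite -lerBlDr. apply: (le_dist px py) => p xp.
rewrite lerBlDr addrC -lerBlDr; apply: le_dist => // q yq.
rewrite lerBlDr addrC -path_length_cat; apply/dist_le_path/(is_path_cat xp yq).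
Qed.

Lemma dist_edge e s t : dist (pt e s) (pt e t) <= `|s - t|.
Proof.
apply: le_trans (dist_le_path (is_path_seg e s t)) _.
by rewrite /path_length big_seq1 /seg_to/seg_from/= distrC clamp_lip.
Qed.

Lemma lipschitz_le_dist (F : rawpoint G -> R) :
  (forall e s t, 0 <= s <= len e -> 0 <= t <= len e ->
    `|F (pt e s) - F (pt e t)| <= `|s - t|) ->
  forall x y, points x -> points y -> `|F x - F y| <= dist x y.
Proof.
move=> FL x y px py; apply: le_dist => // p; elim: p x {px} => [|g p IH] x /=.
  by move=> ->; rewrite subrr normr0 path_length_ge0.
move=> [[wf1 wf2] -> /IH H].
rewrite /path_length big_cons -/(path_length p).
apply: le_trans (ler_distD (F (pt (seg_edge g) (seg_to g))) _ _) _.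
by apply: lerD => //; rewrite [leRHS]distrC; apply: FL.
Qed.

Lemma dist_lip x e s t : points x ->
  `|dist x (pt e s) - dist x (pt e t)| <= `|s - t|.
Proof.
move=> px; have ps := points_pt e s; have pt' := points_pt e t.
have := dist_edge e s t; have := dist_tri px ps pt'; have := dist_tri px pt' ps.
rewrite (dist_sym pt' ps); move: (dist _ _) (dist _ _) (dist _ _) `|s - t| => a b c d.
by move=> *; rewrite ler_norml; apply/andP; split; lra.
Qed.

Lemma edge_lip_le_dist x e (K : R -> R) : points x ->
  (forall s t, 0 <= s <= len e -> 0 <= t <= len e -> `|K s - K t| <= `|s - t|) ->
  K 0 = dist x (inl (src e)) -> K (len e) = dist x (inl (tgt e)) ->
  (forall c, x = inr (e, c) -> K c = 0) ->
  forall t, 0 <= t <= len e -> K t <= dist x (pt e t).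
Proof.
move=> px KL K0 K1 Kx t tl; have l0 := ltW (len_gt0 e).
pose F z : R := if z is inr (e', s) then if e' == e then K s else dist x z else dist x z.
have FE s : 0 <= s <= len e -> F (pt e s) = K s.
  move=> /andP[s0 sl]; case: ptP => [s0'|ls|_ _] /=; last by rewrite eqxx.
  - by rewrite -K0; congr K; apply/eqP; rewrite eq_le s0 s0'.
  - by rewrite -K1; congr K; apply/eqP; rewrite eq_le ls sl.
have FN e' s : e' != e -> F (pt e' s) = dist x (pt e' s).
  by move=> e'e; case: ptP => //= _ _; rewrite (negbTE e'e).
have Fx : F x = 0.
  case: x px @F K0 K1 Kx {FE FN} => [u|[e' c]] px /= K0 K1 Kx; first exact: dist_xx.
  case: eqP => [ee|_]; last exact: dist_xx.
  by rewrite ee in Kx *; exact: Kx.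
have := @lipschitz_le_dist F _ x (pt e t) px (points_pt e t).
rewrite Fx sub0r normrN FE// => H; apply: le_trans (ler_norm _) (H _) => e' s1 s2 h1 h2.
case: (eqVneq e' e) => [ee|ne]; last by rewrite !FN//; exact: dist_lip.
by rewrite ee in h1 h2 *; rewrite !FE//; exact: KL.
Qed.

Lemma lip_min (A B C D k : R) : `|A - C| <= k -> `|B - D| <= k ->
  `|Num.min A B - Num.min C D| <= k.
Proof.
rewrite !ler_norml => /andP[? ?] /andP[? ?].
by case: (leP A B); case: (leP C D) => ? ?; apply/andP; split; lra.
Qed.

Lemma dist_outside x e t : points x -> (forall c, x <> inr (e, c)) -> 0 <= t <= len e ->
  dist x (pt e t) = Num.min (dist x (inl (src e)) + t) (dist x (inl (tgt e)) + (len e - t)).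
Proof.
move=> px xe tl; have l0 := len_gt0 e.
have psrc : points (inl (src e) : rawpoint G) by [].
have ptgt : points (inl (tgt e) : rawpoint G) by [].
have := dist_lip e 0 (len e) px; rewrite [pt e 0]pt_src// [pt e (len e)]pt_tgt//.
rewrite sub0r normrN (ger0_norm (ltW l0)) ler_norml => /andP[AB BA].
apply/eqP; rewrite eq_le; apply/andP; split.
  have := dist_tri px psrc (points_pt e t); have := dist_tri px ptgt (points_pt e t).
  rewrite -{2}(@pt_src e 0)// -{2}(@pt_tgt e (len e))//.
  have := dist_edge e 0 t; have := dist_edge e (len e) t.
  case/andP: tl => t0 tl.
  rewrite sub0r normrN !ger0_norm ?subr_ge0// le_min => *; apply/andP; split; lra.
apply: (edge_lip_le_dist (K := fun t => Num.min (dist x (inl (src e)) + t)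
   (dist x (inl (tgt e)) + (len e - t)))) => //.
- move=> s u _ _; apply: lip_min.
    by rewrite (_ : _ - _ = s - u)//; ring.
  by rewrite (_ : _ - _ = - (s - u)) ?normrN//; ring.
- by rewrite addr0 subr0; apply/min_idPl; lra.
- by rewrite subrr addr0; apply/min_idPr; lra.
- by move=> c /xe.
Qed.

Lemma dist_inside e c t : 0 < c < len e -> 0 <= t <= len e ->
  dist (pt e c) (pt e t) = Num.min `|t - c|
    (Num.min (dist (pt e c) (inl (src e)) + t) (dist (pt e c) (inl (tgt e)) + (len e - t))).
Proof.
move=> cl tl; have l0 := len_gt0 e; set x := pt e c.
have px : points x := points_pt e c.
have psrc : points (inl (src e) : rawpoint G) by [].
have ptgt : points (inl (tgt e) : rawpoint G) by [].
have d0 := dist_ge0 px psrc; have d1 := dist_ge0 px ptgt.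
have := dist_lip e 0 (len e) px; rewrite [pt e 0]pt_src// [pt e (len e)]pt_tgt//.
rewrite sub0r normrN (ger0_norm (ltW l0)) ler_norml => /andP[AB BA].
have := dist_edge e c 0; have := dist_edge e c (len e).
rewrite -/x [pt e 0]pt_src// [pt e (len e)]pt_tgt// subr0.
case/andP: (cl) => c0 cl'; rewrite (ger0_norm (ltW c0)) (ler0_norm (_ : c - len e <= 0)); last lra.
move=> A1 B1.
apply/eqP; rewrite eq_le; apply/andP; split.
  have := dist_tri px psrc (points_pt e t); have := dist_tri px ptgt (points_pt e t).
  rewrite -{2}(@pt_src e 0)// -{2}(@pt_tgt e (len e))//.
  have := dist_edge e 0 t; have := dist_edge e (len e) t; have := dist_edge e c t.
  case/andP: tl => t0 tl; rewrite -/x (distrC t c).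
  rewrite sub0r normrN (ger0_norm t0) (ger0_norm (_ : 0 <= len e - t)) ?subr_ge0//.
  by rewrite !le_min => -> *; apply/andP; split; lra.
apply: (edge_lip_le_dist (K := fun t => Num.min `|t - c| (Num.min (dist x (inl (src e)) + t)
   (dist x (inl (tgt e)) + (len e - t))))) => //.
- move=> s u _ _; apply: lip_min.
    by apply: le_trans (ler_dist_dist _ _) _; rewrite (_ : _ - _ - _ = s - u)//; ring.
  apply: lip_min.
    by rewrite (_ : _ - _ = s - u)//; ring.
  by rewrite (_ : _ - _ = - (s - u)) ?normrN//; ring.
- rewrite addr0 subr0 sub0r normrN ger0_norm ?ltW// (min_idPl (_ : _ <= _ + len e)); last lra.
  by apply/min_idPr; lra.
- rewrite subrr addr0 ger0_norm ?subr_ge0 ?ltW//.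
  rewrite (min_idPr (_ : _ <= _ + len e)); last lra.
  by apply/min_idPr; lra.
- move=> c' xc; have : @inr (vert G) _ (e, c) = inr (e, c') by rewrite -xc /x pt_in.
  move=> -[<-]; rewrite subrr normr0; apply/min_idPl.
  by rewrite le_min; apply/andP; split; lra.
Qed.

Lemma finite_min (I : finType) (P : I -> R -> Prop) :
  (forall i a b, b <= a -> P i a -> P i b) ->
  (forall i, exists2 a, 0 < a & P i a) -> exists2 a, 0 < a & forall i, P i a.
Proof.
move=> Pd PI; suff [a a0 aP] : exists2 a, 0 < a & forall i, i \in enum I -> P i a.
  by exists a => // i; apply: aP; rewrite mem_enum.
elim: (enum I) => [|i s [a a0 IH]]; first by exists 1.
have [b b0 bP] := PI i; exists (Num.min a b); first by rewrite lt_min a0 b0.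
move=> j; rewrite inE => /predU1P[->|/IH].
  by apply: Pd bP; rewrite ge_min lexx orbT.
by apply: Pd; rewrite ge_min lexx.
Qed.

Lemma potential_le_dist (phi : vert G -> R) :
  (forall e, `|phi (src e) - phi (tgt e)| <= len e) ->
  forall u v, `|phi u - phi v| <= dist (inl u : rawpoint G) (inl v).
Proof.
move=> phiL u v.
pose K e t := Num.min (phi (src e) + t) (phi (tgt e) + (len e - t)).
pose F (z : rawpoint G) := match z with inl w => phi w | inr (e, t) => K e t end.
have FE e s : 0 <= s <= len e -> F (pt e s) = K e s.
  move=> /andP[s0 sl]; have := phiL e; rewrite ler_norml => /andP[? ?].
  case: ptP => [s0'|ls|_ _] //=; rewrite /K.
  - by rewrite (min_idPl _); lra.
  - by rewrite (min_idPr _); lra.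
apply: (@lipschitz_le_dist F _ (inl u) (inl v) I I) => e s t sl tl; rewrite !FE//; apply: lip_min.
  by rewrite (_ : _ - _ = s - t)//; ring.
by rewrite (_ : _ - _ = - (s - t)) ?normrN//; ring.
Qed.

Lemma dist_vert_gt0 u v : u != v -> 0 < dist (inl u : rawpoint G) (inl v).
Proof.
move=> uv; have [a a0 aP] : exists2 a, 0 < a & forall e : edge G, a <= len e.
  apply: finite_min => [i a b ba ai|e]; first exact: le_trans ai.
  by exists (len e) => //; exact: len_gt0.
apply: (lt_le_trans a0).
have := @potential_le_dist (fun w => if w == u then 0 else a) _ u v.
rewrite eqxx eq_sym (negbTE uv) sub0r normrN (ger0_norm (ltW a0)); apply=> e.
by case: eqP => _; case: eqP => _; rewrite ?subrr ?subr0 ?sub0r ?normr0 ?normrN;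
  rewrite ?(ger0_norm (ltW a0)) ?(ltW (len_gt0 e)).
Qed.

Lemma dist_eq0 x y : points x -> points y -> dist x y = 0 -> x = y.
Proof.
have vin u e t : 0 < t < len e -> 0 < dist (inl u : rawpoint G) (inr (e, t)).
  move=> h; case/andP: (h) => t0 tl; rewrite -(pt_in h) dist_outside//; last by rewrite !ltW.
  rewrite lt_min; apply/andP; split; rewrite ltr_wpDl ?subr_gt0//; exact: dist_ge0.
case: x => [u|[e c]]; case: y => [v|[f t]] px py.
- by case: (eqVneq u v) => [->//|/dist_vert_gt0 h] h0; rewrite h0 ltxx in h.
- by move=> h0; have := vin u _ _ py; rewrite h0 ltxx.
- by rewrite dist_sym// => h0; have := vin v _ _ px; rewrite h0 ltxx.
case: (eqVneq e f) => [ef|ne].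
  subst f; case: (eqVneq t c) => [->//|tc].
  rewrite /= in px py; case/andP: (py) => t0 tl.
  rewrite -{1}(pt_in px) -{1}(pt_in py) dist_inside//; last by rewrite !ltW.
  move=> h; suff : 0 < Num.min `|t - c| (Num.min (dist (pt e c) (inl (src e)) + t)
      (dist (pt e c) (inl (tgt e)) + (len e - t))) by rewrite h ltxx.
  rewrite !lt_min normr_gt0 subr_eq0 tc/=; apply/andP; split;
    by rewrite ltr_wpDl ?subr_gt0//; apply: dist_ge0 => //; exact: points_pt.
rewrite /= in py; case/andP: (py) => t0 tl.
rewrite -(pt_in py) dist_outside//; last 2 first.
  by move=> c' [ef _]; rewrite ef eqxx in ne.
  by rewrite !ltW.
move=> h; suff : 0 < Num.min (dist (inr (e, c)) (inl (src f)) + t)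
    (dist (inr (e, c)) (inl (tgt f)) + (len f - t)) by rewrite h ltxx.
rewrite lt_min; apply/andP; split; rewrite ltr_wpDl ?subr_gt0//; exact: dist_ge0.
Qed.

End Metric.

Section Continuity.
Context {R : realType}.

Lemma continuous_lip (f : R -> R) k :
  (forall s t, `|f s - f t| <= k * `|s - t|) -> continuous f.
Proof.
move=> fk; have k0 : 0 <= k.
  by have := fk 1 0; rewrite subr0 normr1 mulr1; exact: le_trans (normr_ge0 _).
move=> x; apply/cvgrPdist_lt => eps e0; apply/nbhs_ballP.
have k1 : 0 < k + 1 by lra.
exists (eps / (k + 1)) => /=; first exact: divr_gt0.
move=> y /=; rewrite /ball/= lter_pdivlMr// => xy.
apply: le_lt_trans (fk x y) _; apply: le_lt_trans xy.
by rewrite mulrC ler_wpM2l//; lra.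
Qed.

Lemma ivt_strict (f : R -> R) a b r : continuous f -> f a < r < f b ->
  exists c, Num.min a b < c < Num.max a b /\ f c = r.
Proof.
move=> cf /andP[ar rb].
have H u v : u <= v -> Num.min (f u) (f v) <= r <= Num.max (f u) (f v) ->
    exists2 c, u <= c <= v & f c = r.
  by move=> uv h; have [|c] := IVT uv _ h; [exact: continuous_subspaceT | exists c].
have rab : Num.min (f a) (f b) <= r <= Num.max (f a) (f b).
  by rewrite ge_min le_max (ltW ar) (ltW rb) orbT.
case: (leP a b) => ab.
  have [c /andP[ac cb] fc] := H a b ab rab; exists c; split => //.
  rewrite !lt_neqAle ac cb !andbT; apply/andP; split; apply/eqP => E; move: ar rb;
    by rewrite -fc E ltxx.
have [|c /andP[ac cb] fc] := H b a (ltW ab); first by rewrite minC maxC.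
exists c; split => //.
rewrite !lt_neqAle ac cb !andbT; apply/andP; split; apply/eqP => E; move: ar rb;
  by rewrite -fc E ltxx.
Qed.

End Continuity.

Section Levels.
Context {R : realType} {G : metricGraph R}.
Implicit Types (x y z : rawpoint G) (e f : edge G) (p q : seq (segment G)).
Implicit Types (s t r : R) (u v w : vert G) (g h : rawpoint G -> R).

Definition gcontinuous g := forall e, continuous (fun s => g (pt e s)).

Lemma dist_continuous x : points x -> gcontinuous (dist x).
Proof.
by move=> px e; apply: (@continuous_lip _ _ 1) => s t; rewrite mul1r; exact: dist_lip.
Qed.

Lemma path_cross g x p y r : gcontinuous g -> is_path x p y -> g x < r < g y ->
  (forall c, c \in p -> g (pt (seg_edge c) (seg_to c)) <> r) ->
  exists c s, [/\ c \in p, seg_interior c s & g (pt (seg_edge c) s) = r].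
Proof.
move=> cg; elim: p x => [|c p IH] x /=.
  by move=> -> /andP[/lt_trans h /h]; rewrite ltxx.
move=> [wf -> H] /andP[gx gy] Hr.
case: (ltgtP (g (pt (seg_edge c) (seg_to c))) r) => [lt|gt|E]; last first.
- by case: (Hr c); first exact: mem_head.
- have [|s [sm gs]] := @ivt_strict _ (fun s => g (pt (seg_edge c) s))
      (seg_from c) (seg_to c) r (cg _).
    by rewrite gx gt.
  by exists c, s; split=> //; exact: mem_head.
have [|c' cp|c' [s [cp ? ?]]] := IH _ H; first by rewrite lt gy.
  by apply: Hr; rewrite inE cp orbT.
by exists c', s; split=> //; rewrite inE cp orbT.
Qed.

Lemma path_level g x p y r : gcontinuous g -> points x -> points y ->
  is_path x p y -> g x <= r <= g y ->
  exists z, [/\ points z, g z = r & dist x z + dist z y <= path_length p].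
Proof.
move=> cg; elim: p x => [|c p IH] x px py /=.
  move=> <- /andP[h1 h2]; exists x; split=> //; first by apply/eqP; rewrite eq_le h1 h2.
  by rewrite !dist_xx// addr0 path_length_ge0.
move=> [wf -> H] /andP[gx gy].
rewrite /path_length big_cons -/(path_length p).
set e := seg_edge c; have ps t := points_pt e t.
have [gt|lt] := leP r (g (pt e (seg_to c))).
  have [s sc gs] : exists2 s, Num.min (seg_from c) (seg_to c) <= s <=
      Num.max (seg_from c) (seg_to c) & g (pt e s) = r.
    move: gx; rewrite le_eqVlt => /predU1P[E|gx].
      by exists (seg_from c) => //; rewrite ge_min le_max lexx.
    move: gt; rewrite le_eqVlt => /predU1P[E|gt].
      by exists (seg_to c) => //; rewrite ge_min le_max lexx !orbT.
    have [|s [/andP[s1 s2] gs]] := @ivt_strict _ (fun s => g (pt e s))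
        (seg_from c) (seg_to c) r (cg _).
      by rewrite gx gt.
    by exists s => //; rewrite !ltW.
  exists (pt e s); split => //.
  have := dist_tri (ps s) (ps (seg_to c)) py; have := dist_edge e (seg_from c) s.
  have := dist_edge e s (seg_to c); have := dist_le_path H.
  have : `|seg_to c - seg_from c| = `|seg_from c - s| + `|s - seg_to c|.
    move: sc; case: (leP (seg_from c) (seg_to c)) => h /andP[h1 h2].
      rewrite ger0_norm ?ler0_norm; lra.
    by rewrite (@ler0_norm _ (_ - seg_from c)) ?(@ger0_norm _ (_ - s)) ?(@ger0_norm _ (s - _)); lra.
  by rewrite -/e; move=> -> *; lra.
have [//|z [pz gz dz]] := IH _ (ps (seg_to c)) py H; first by rewrite (ltW lt) gy.
exists z; split=> //.
have := dist_tri (ps (seg_from c)) (ps (seg_to c)) pz.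
by have := dist_edge e (seg_from c) (seg_to c); rewrite distrC; lra.
Qed.

(* The infimum over all points z of the defect below is 0 by path_level; it is
   attained since the graph is a finite union of compact edges. *)
Lemma dist_between x y t : points x -> points y -> 0 <= t <= dist x y ->
  exists z, [/\ points z, dist x z = t & dist z y = dist x y - t].
Proof.
move=> px py /andP[t0 td].
pose D z := `|dist x z - t| + `|dist y z - (dist x y - t)|.
have D0 z : 0 <= D z by rewrite addr_ge0.
apply: contrapT => noz.
have Dgt0 z : points z -> 0 < D z.
  move=> pz; rewrite lt_neqAle D0 andbT; apply/eqP => Dz; apply: noz.
  have : D z == 0 by rewrite -Dz.
  rewrite paddr_eq0// !normr_eq0 !subr_eq0 => /andP[/eqP d1 /eqP d2].
  by exists z; split; rewrite // dist_sym.
have [a a0 aP] : exists2 a, 0 < a & forall e s, a <= D (pt e s).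
  apply: finite_min => [e a b ba ai s|e]; first exact: le_trans (ai s).
  have cD : continuous (fun s => D (pt e s)).
    apply: (@continuous_lip _ _ 2) => s u; rewrite /D.
    have := dist_lip e s u px; have := dist_lip e s u py.
    have lip (A B c k : R) : `|A - B| <= k -> `|(`|A - c| - `|B - c|)| <= k.
      apply: le_trans; apply: le_trans (ler_dist_dist _ _) _.
      by rewrite opprB addrA subrK.
    move=> h2 h1; have {}h2 := lip _ _ (dist x y - t) _ h2; have {}h1 := lip _ _ t _ h1.
    have tri (a b c k : R) : `|a + b - (c + k)| <= `|a - c| + `|b - k|.
      by rewrite opprD addrACA ler_normD.
    apply: le_trans (tri _ _ _ _) _.
    by rewrite mulr_natl mulr2n; apply: lerD.
  have [|c _ cP] := @EVT_min _ (fun s => D (pt e s)) 0 (len e) (ltW (len_gt0 e)).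
    exact: continuous_subspaceT.
  exists (D (pt e c)); first by apply: Dgt0; exact: points_pt.
  by move=> s; rewrite -(pt_clamp e s); apply: cP; rewrite in_itv/= clamp_itv.
have [b b0 bP] : exists2 b, 0 < b & forall v, b <= D (inl v).
  apply: finite_min => [e b c cb ai|v]; first exact: le_trans ai.
  by exists (D (inl v)) => //; exact: Dgt0.
pose k := Num.min a b.
have k0 : 0 < k by rewrite lt_min a0.
have kP z : points z -> k <= D z.
  case: z => [v _|[e s] /pt_in <-]; first by rewrite ge_min bP orbT.
  by rewrite ge_min aP.
have [p xp pl] := dist_approx px py (divr_gt0 k0 (ltr0n R 2)).
have [|z [pz gz dz]] := path_level (dist_continuous px) px py xp (r := t).
  by rewrite dist_xx// t0.
have := kP z pz; rewrite /D gz subrr normr0 add0r (dist_sym py pz).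
have := dist_tri px pz py; rewrite gz => h1 h2.
have := ger0_norm (_ : 0 <= dist z y - (dist x y - t)) => h3.
by move: h2; rewrite h3; lra.
Qed.

End Levels.

(** * Integrals over the graph *)

Section GraphIntegral.
Context {R : realType} {G : metricGraph R}.
Implicit Types (x y z : rawpoint G) (e f : edge G) (H : {set edge G}).
Implicit Types (s t r : R) (u v w : vert G) (g h : rawpoint G -> R).

Definition integral_on H g : R := \sum_(e in H) itg 0 (len e) (fun s => g (pt e s)).

Definition length_on H : R := \sum_(e in H) len e.

Lemma graph_integralE g : graph_integral g = integral_on [set: edge G]%SET g.
Proof. by apply: eq_bigl => e; rewrite inE. Qed.

Lemma total_lengthE : total_length G = length_on [set: edge G]%SET.
Proof. by apply: eq_bigl => e; rewrite inE. Qed.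

Lemma card_edge_gt0 : 0 < total_length G -> (0 < #|edge G|)%N.
Proof.
move=> L0; rewrite lt0n; apply/eqP => /card0_eq E0.
by move: L0; rewrite /total_length big_pred0 ?ltxx// => e; have := E0 e; rewrite inE.
Qed.

Lemma length_on_ge0 H : 0 <= length_on H.
Proof. by apply: sumr_ge0 => e _; exact/ltW/len_gt0. Qed.

Lemma integral_onD H g h : gcontinuous g -> gcontinuous h ->
  integral_on H (fun x => g x + h x) = integral_on H g + integral_on H h.
Proof. by move=> cg ch; rewrite -big_split/=; apply: eq_bigr => e _; rewrite itgD. Qed.

Lemma integral_onZ H k g : gcontinuous g ->
  integral_on H (fun x => k * g x) = k * integral_on H g.
Proof. by move=> cg; rewrite mulr_sumr; apply: eq_bigr => e _; rewrite itgZ. Qed.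

Lemma integral_on_cst H k : integral_on H (fun=> k) = k * length_on H.
Proof.
by rewrite mulr_sumr; apply: eq_bigr => e _; rewrite itg_cst ?subr0 ?(ltW (len_gt0 e)).
Qed.

Lemma le_integral_on H g h : gcontinuous g -> gcontinuous h ->
  (forall x, points x -> g x <= h x) -> integral_on H g <= integral_on H h.
Proof.
move=> cg ch gh; apply: ler_sum => e _; apply: le_itg => // s _.
by apply: gh; exact: points_pt.
Qed.

Lemma gcontinuous_cst k : gcontinuous (fun _ : rawpoint G => k).
Proof. by move=> e; exact: cst_continuous. Qed.

Lemma gcontinuousD g h : gcontinuous g -> gcontinuous h -> gcontinuous (fun x => g x + h x).
Proof. by move=> cg ch e; apply: continuous_addr. Qed.

Lemma continuous_eq_itg a b (f1 f2 : R -> R) : a < b -> continuous f1 -> continuous f2 ->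
  (forall s, a < s < b -> f1 s = f2 s) -> forall s, a <= s <= b -> f1 s = f2 s.
Proof.
move=> ab c1 c2 E; pose d s := f1 s - f2 s.
have cd : continuous d by apply: continuous_addr => //; exact: continuous_oppr.
move=> s sab; apply/eqP; rewrite -subr_eq0; apply/negPn/negP => ds.
have /cvgrPdist_lt/(_ `|d s|) : d y @[y --> s] --> d s := cd s.
rewrite normr_gt0 => /(_ ds)/nbhs_ballP[e /= e0 He].
pose m := (a + b) / 2; pose k := Num.min 1 (e / (2 * (b - a))).
have ba : 0 < b - a by rewrite subr_gt0.
have k0 : 0 < k by rewrite lt_min ltr01 divr_gt0// mulr_gt0.
have k1 : k <= 1 by rewrite ge_min lexx.
have ke : k * (b - a) <= e / 2.
  have : k <= e / (2 * (b - a)) by rewrite ge_min lexx orbT.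
  by rewrite lter_pdivlMr ?mulr_gt0//; lra.
have sm : a < s + k * (m - s) < b.
  case/andP: sab => sa sb; rewrite /m; apply/andP; split; nra.
have : ball s e (s + k * (m - s)).
  rewrite /ball/= opprD addNKr normrN normrM gtr0_norm//.
  have : `|m - s| <= (b - a) by rewrite /m ler_norml; case/andP: sab => *; apply/andP; split; lra.
  by move=> h; nra.
by move=> /He; rewrite /d (E _ sm) subrr subr0 ltxx.
Qed.

Lemma sum_itg_eq H (phi psi : edge G -> R -> R) :
  (forall e, continuous (phi e)) -> (forall e, continuous (psi e)) ->
  (forall e s, 0 < s < len e -> phi e s <= psi e s) ->
  \sum_(e in H) itg 0 (len e) (psi e) <= \sum_(e in H) itg 0 (len e) (phi e) ->
  forall e s, e \in H -> 0 <= s <= len e -> phi e s = psi e s.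
Proof.
move=> cphi cpsi le hg e s eH; apply: (continuous_eq_itg (len_gt0 e) (cphi e) (cpsi e)).
have lei f : itg 0 (len f) (phi f) <= itg 0 (len f) (psi f).
  by apply: le_itg => // t; exact: le.
apply: itg_eq_le => //; first exact: le.
move: hg; rewrite (bigD1 e)//= [leRHS](bigD1 e)//= => hg.
have : \sum_(i in H | i != e) itg 0 (len i) (phi i) <=
       \sum_(i in H | i != e) itg 0 (len i) (psi i) by apply: ler_sum.
lra.
Qed.

Lemma integral_on_eq H g h : gcontinuous g -> gcontinuous h ->
  (forall x, points x -> g x <= h x) -> integral_on H h <= integral_on H g ->
  forall e s, e \in H -> g (pt e s) = h (pt e s).
Proof.
move=> cg ch gh hg e s eH; rewrite -(pt_clamp e s).
apply: (sum_itg_eq cg ch _ hg eH); last exact: clamp_itv.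
by move=> f t _; apply: gh; exact: points_pt.
Qed.

Definition dist_integral H x := integral_on H (dist x).

Lemma dist_integral_lip H x y : points x -> points y ->
  `|dist_integral H x - dist_integral H y| <= length_on H * dist x y.
Proof.
have sub a b : points a -> points b ->
    dist_integral H a <= dist_integral H b + length_on H * dist a b.
  move=> pa pb; rewrite mulrC -integral_on_cst -integral_onD; last 2 first.
    exact: dist_continuous.
    exact: gcontinuous_cst.
  apply: le_integral_on; [exact: dist_continuous| |].
    by apply: gcontinuousD; [exact: dist_continuous|exact: gcontinuous_cst].
  by move=> z pz; rewrite addrC; apply: dist_tri.
move=> px py; have := sub x y px py; have := sub y x py px; rewrite (dist_sym py px).
by rewrite ler_norml => *; apply/andP; split; lra.
Qed.

Lemma dist_integral_continuous H : gcontinuous (dist_integral H).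
Proof.
move=> e; apply: (@continuous_lip _ _ (length_on H)) => s t.
apply: le_trans (dist_integral_lip _ (points_pt e s) (points_pt e t)) _.
by rewrite ler_wpM2l ?length_on_ge0// dist_edge.
Qed.

Lemma mean_distanceE :
  mean_distance G =
    integral_on [set: edge G]%SET (dist_integral [set: edge G]%SET) / total_length G ^+ 2.
Proof.
rewrite /mean_distance mulrC graph_integralE; congr (_ / _).
apply: eq_bigr => e _; apply: eq_itg => s _; exact: graph_integralE.
Qed.

End GraphIntegral.

(** * The lower bound *)

Section AbsIntegral.
Context {R : realType}.

Lemma continuous_dist (c : R) : continuous (fun t => `|t - c|).
Proof.
apply: (@continuous_lip _ _ 1) => s t; rewrite mul1r.
by apply: le_trans (ler_dist_dist _ _) _; rewrite opprB addrA subrK.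
Qed.

Lemma itg_dist (a b c : R) : a <= b ->
  itg a b (fun t => `|t - c|) = ((b - c) * `|b - c| - (a - c) * `|a - c|) / 2.
Proof.
have R0 u v : u <= v -> c <= u -> itg u v (fun t => `|t - c|) = ((v - c) ^+ 2 - (u - c) ^+ 2) / 2.
  move=> uv cu; rewrite (@eq_itg _ _ _ _ (fun t => t - c)); last first.
    by move=> t /andP[ut _]; rewrite ger0_norm// subr_ge0 ltW// (le_lt_trans cu).
  rewrite itgB ?itg_id ?itg_cst//; first by field.
    by move=> x; exact: cvg_id.
  exact: cst_continuous.
have L0 u v : u <= v -> v <= c -> itg u v (fun t => `|t - c|) = ((u - c) ^+ 2 - (v - c) ^+ 2) / 2.
  move=> uv cv; rewrite (@eq_itg _ _ _ _ (fun t => c - t)); last first.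
    by move=> t /andP[_ tv]; rewrite ler0_norm ?opprB// subr_le0 ltW// (lt_le_trans tv).
  rewrite itgB ?itg_id ?itg_cst//; first by field.
    exact: cst_continuous.
  by move=> x; exact: cvg_id.
move=> ab; case: (leP c a) => ca.
  by rewrite R0// !ger0_norm ?subr_ge0 ?(le_trans ca)//; ring.
case: (leP b c) => bc.
  by rewrite L0// !ler0_norm ?subr_le0 ?(ltW ca)//; ring.
rewrite (@itg_split _ a c b); [|exact: continuous_dist|by rewrite !ltW].
rewrite (L0 _ _ (ltW ca) (lexx c)) (R0 _ _ (ltW bc) (lexx c)).
rewrite (@ger0_norm _ (b - c)) ?subr_ge0 ?ltW// (@ler0_norm _ (a - c)) ?subr_le0 ?ltW//.
by ring.
Qed.

Definition end_dist (l s : R) := Num.min s (l - s).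

Lemma end_distE (l s : R) : end_dist l s = l / 2 - `|s - l / 2|.
Proof.
rewrite /end_dist; case: (leP s (l - s)) => h.
  by rewrite ler0_norm; lra.
by rewrite ger0_norm; lra.
Qed.

Lemma end_dist_continuous l : continuous (end_dist l).
Proof.
have -> : end_dist l = (fun s : R => l / 2 - `|s - l / 2|) by apply/funext => s; exact: end_distE.
apply: continuous_addr; first exact: cst_continuous.
by apply: continuous_oppr; exact: continuous_dist.
Qed.

Lemma itg_end_dist (l : R) : 0 <= l -> itg 0 l (end_dist l) = l ^+ 2 / 4.
Proof.
move=> l0; rewrite (@eq_itg _ _ _ _ (fun s => l / 2 - `|s - l / 2|)); last first.
  by move=> s _; exact: end_distE.
rewrite itgB; [|exact: cst_continuous|exact: continuous_dist].
rewrite itg_cst// itg_dist// ger0_norm ?ler0_norm; [by field|lra|lra].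
Qed.

Lemma circle_distE (l s t : R) : 0 < l -> `|s - t| <= l ->
  circle_dist l s t = l - `|t - (s + l / 2)| - `|t - (s - l / 2)| + `|t - s|.
Proof.
move=> l0; rewrite /circle_dist distrC; case: (leP 0 (t - s)) => h.
  rewrite (ger0_norm h) => hl; rewrite (@ger0_norm _ (t - (s - _))); last lra.
  by case: (leP (t - s) (l - (t - s))) => h';
    [rewrite ler0_norm|rewrite ger0_norm]; lra.
rewrite (ltr0_norm h) => hl; rewrite (@ler0_norm _ (t - (s + _))); last lra.
by case: (leP (- (t - s)) (l - (- (t - s)))) => h';
  [rewrite ger0_norm|rewrite ler0_norm]; lra.
Qed.

Lemma circle_dist_continuous (l s : R) : continuous (circle_dist l s).
Proof.
apply: (@continuous_lip _ _ 1) => t u; rewrite mul1r /circle_dist.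
have H : `|(`|s - t| - `|s - u|)| <= `|t - u|.
  apply: le_trans (ler_dist_dist _ _) _.
  by rewrite (_ : _ - _ = - (t - u)) ?normrN//; ring.
apply: lip_min => //.
by rewrite (_ : _ - _ = - (`|s - t| - `|s - u|)) ?normrN//; ring.
Qed.

Lemma itg_circle_dist (l s : R) : 0 < l -> 0 <= s <= l -> itg 0 l (circle_dist l s) = l ^+ 2 / 4.
Proof.
move=> l0 /andP[s0 sl]; rewrite (@eq_itg _ _ _ _ (fun t =>
  l - `|t - (s + l / 2)| - `|t - (s - l / 2)| + `|t - s|)); last first.
  move=> t /andP[t0 tl]; apply: circle_distE => //.
  by rewrite ler_norml; apply/andP; split; lra.
have cd := continuous_dist; have cc := @cst_continuous R R.
rewrite itgD//; last first.
  by do 2?[apply: continuous_addr; last exact: continuous_oppr].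
rewrite itgB//; last by apply: continuous_addr; last exact: continuous_oppr.
rewrite itgB// itg_cst ?ltW// !itg_dist ?ltW//.
rewrite !sub0r !normrN.
rewrite (@ger0_norm _ (s + _)); last lra.
rewrite (@ger0_norm _ (l - (s - _))); last lra.
rewrite (@ger0_norm _ (l - s)); last lra.
rewrite (@ger0_norm _ s)//.
rewrite (_ : l - (s + l / 2) = - (s - l / 2)) ?normrN; last by field.
by case: (leP 0 (s - l / 2)) => h; [rewrite ger0_norm//|rewrite ltr0_norm//]; field.
Qed.

End AbsIntegral.

Section LowerBound.
Context {R : realType} {G : metricGraph R}.
Implicit Types (e f : edge G) (s t : R).

Local Notation L := (total_length G).

Let low e s f t : R := if f == e then circle_dist (len e) s t
                       else end_dist (len e) s + end_dist (len f) t.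

Let low_continuous e s f : continuous (low e s f).
Proof.
rewrite /low; case: eqP => _; first exact: circle_dist_continuous.
by apply: continuous_addr; [exact: cst_continuous|exact: end_dist_continuous].
Qed.

Lemma end_dist_le_vertex e s v : 0 < s < len e ->
  end_dist (len e) s <= dist (pt e s) (inl v).
Proof.
move=> h; rewrite dist_sym//; last exact: points_pt.
rewrite dist_outside//; last by case/andP: h => ? ?; rewrite !ltW.
have := @dist_ge0 R G (inl v) (inl (src e)) I I.
have := @dist_ge0 R G (inl v) (inl (tgt e)) I I.
rewrite /end_dist le_min !ge_min => ? ?.
by apply/andP; split; apply/orP; [left|right]; lra.
Qed.

Let low_le e s f t : 0 < s < len e -> 0 < t < len f ->
  low e s f t <= dist (pt e s) (pt f t).
Proof.
move=> hs ht; have hA := end_dist_le_vertex (src f) hs.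
have hB := end_dist_le_vertex (tgt f) hs.
have ht' : 0 <= t <= len f by case/andP: ht => ? ?; rewrite !ltW.
rewrite /low; case: eqP => [fe|fe].
  subst f; rewrite dist_inside// /circle_dist distrC le_min ge_min lexx/=.
  case/andP: hs => s0 sl; case/andP: ht => t0 tl.
  move: hA hB; rewrite /end_dist; case: (leP s (len e - s)) => _ hA hB;
    rewrite le_min !ge_min; apply/andP; split; apply/orP;
    case: (leP 0 (t - s)) => h; rewrite ?(ger0_norm h) ?(ltr0_norm h);
    solve [left; lra|right; lra].
rewrite dist_outside//; [|exact: points_pt|by move=> c; rewrite pt_in// => -[ef]; rewrite ef in fe].
rewrite le_min; apply/andP; split; rewrite lerD// /end_dist ge_min lexx ?orbT//.
Qed.

Let lowD e s := \sum_f itg 0 (len f) (low e s f).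

Let S2 := \sum_(f : edge G) len f ^+ 2.
Let S3 := \sum_(f : edge G) len f ^+ 3.

Let lowDE e s : 0 <= s <= len e ->
  lowD e s = S2 / 4 + (L - len e) * end_dist (len e) s.
Proof.
move=> h; rewrite /lowD (bigD1 e)//= {1}/low eqxx itg_circle_dist//; last exact: len_gt0.
have -> : L - len e = \sum_(f | f != e) len f.
  by rewrite /total_length (bigD1 e)//= addrAC subrr add0r.
have -> : S2 = len e ^+ 2 + \sum_(f | f != e) len f ^+ 2 by rewrite /S2 (bigD1 e).
rewrite mulrDl -addrA; congr (_ + _); rewrite 2!mulr_suml -big_split/=.
apply: eq_bigr => f fe; rewrite {1}/low (negbTE fe) itgD; last 2 first.
  exact: cst_continuous.
  exact: end_dist_continuous.
have l0 := ltW (len_gt0 f).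
by rewrite itg_cst// itg_end_dist// subr0 addrC [_ * len f]mulrC.
Qed.

Let lowD_continuous e : continuous (fun s => S2 / 4 + (L - len e) * end_dist (len e) s).
Proof.
apply: continuous_addr; first exact: cst_continuous.
by move=> s; apply: cvgMr; exact: end_dist_continuous.
Qed.

Let sum_lowD : \sum_(e : edge G) itg 0 (len e) (fun s => S2 / 4 + (L - len e) * end_dist (len e) s)
  = L * S2 / 2 - S3 / 4.
Proof.
rewrite (eq_bigr (fun e => S2 / 4 * len e + (L / 4 * len e ^+ 2 - 4^-1 * len e ^+ 3))).
  rewrite big_split/= sumrB -!mulr_sumr -/(total_length G) -/S2 -/S3; by field.
move=> e _; have ce := @end_dist_continuous R (len e).
have l0 := ltW (len_gt0 e).
rewrite itgD; [|exact: cst_continuous|by move=> s; apply: cvgMr; exact: ce].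
by rewrite itg_cst// itgZ// itg_end_dist//; field.
Qed.

Let Dl_ge e s : 0 < s < len e ->
  S2 / 4 + (L - len e) * end_dist (len e) s <= dist_integral [set: edge G]%SET (pt e s).
Proof.
move=> h; rewrite -lowDE; last by case/andP: h => ? ?; rewrite !ltW.
rewrite /dist_integral /integral_on [leRHS](eq_bigl xpredT); last by move=> f; rewrite inE.
apply: ler_sum => f _; apply: le_itg; [exact: low_continuous| |by move=> t; exact: low_le].
by apply: dist_continuous; exact: points_pt.
Qed.

Let W := integral_on [set: edge G]%SET (dist_integral [set: edge G]%SET).

Let W_ge : L * S2 / 2 - S3 / 4 <= W.
Proof.
rewrite -sum_lowD /W /integral_on [leRHS](eq_bigl xpredT); last by move=> f; rewrite inE.
apply: ler_sum => e _; apply: le_itg; [exact: lowD_continuous| |by move=> s; exact: Dl_ge].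
exact: dist_integral_continuous.
Qed.

Context (L0 : 0 < L).

Let E := #|edge G|%:R : R.
Let m := L / E.

Let E_ge1 : 1 <= E.
Proof. by rewrite /E ler1n card_edge_gt0. Qed.

Let gap e := (len e - m) ^+ 2 * (2 * L - len e - 2 * m).

(* The summand at edge length l exceeds its tangent line at l = m by gap / 4. *)
Let power_sums : L * S2 / 2 - S3 / 4 =
  (2 * E - 1) / (4 * E ^+ 2) * L ^+ 3 + (\sum_e gap e) / 4.
Proof.
have En0 : E != 0 by rewrite gt_eqF// (lt_le_trans ltr01 E_ge1).
have sumgap : \sum_e gap e = 2 * L * S2 - S3 - (4 * L * m - 3 * m ^+ 2) * L
    + E * (2 * L * m ^+ 2 - 2 * m ^+ 3).
  rewrite (eq_bigr (fun e => 2 * L * len e ^+ 2 - len e ^+ 3 -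
      (4 * L * m - 3 * m ^+ 2) * len e + (2 * L * m ^+ 2 - 2 * m ^+ 3))); last first.
    by move=> e _; rewrite /gap; ring.
  rewrite big_split/= sumr_const -[X in _ + X]mulr_natl !sumrB -!mulr_sumr.
  by rewrite -/(total_length G) -/S2 -/S3.
rewrite sumgap /m; field.
exact: En0.
Qed.

Let gap_ge0 e : 0 <= gap e /\ (gap e = 0 -> len e = m).
Proof.
have El0 : 0 < E by exact: lt_le_trans ltr01 E_ge1.
have le_L : len e <= L.
  rewrite /total_length (bigD1 e)//= lerDl; apply: sumr_ge0 => f _; exact/ltW/len_gt0.
have [E1|E1] := eqVneq #|edge G| 1%N.
  have lm : len e = m.
    rewrite /m /E E1 divr1 /total_length; have /fintype1P[e0 e0P] : #|edge G| == 1%N by rewrite E1.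
    by rewrite (bigD1 e)//= big1 ?addr0// => f; rewrite (e0P f) (e0P e) eqxx.
  by rewrite /gap lm subrr expr0n mul0r.
have E2 : 2 <= E.
  have := E_ge1; rewrite /E ler1n ler_nat => E_1; rewrite ltn_neqAle eq_sym E1/=; exact: E_1.
have mL : 2 * m <= L.
  rewrite /m mulrA ler_pdivrMr// mulrC ler_wpM2l// ltW//.
have lt_L : len e < L.
  rewrite lt_neqAle le_L andbT; apply/eqP => eL.
  have /card_gt0P[f fe] : (0 < #|predC1 e|)%N.
    rewrite cardC1; move: E2; rewrite /E ler_nat; by case: #|_| => [|[]].
  move: eL; rewrite /total_length (bigD1 e)//= (bigD1 f)//=.
  have : 0 <= \sum_(i | (i != e) && (i != f)) len i by apply: sumr_ge0 => i _; exact/ltW/len_gt0.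
  by have := len_gt0 f; lra.
have g0 : 0 < 2 * L - len e - 2 * m by lra.
split; first by rewrite mulr_ge0 ?sqr_ge0// ltW.
by move/eqP; rewrite mulf_eq0 (gt_eqF g0) orbF sqrf_eq0 subr_eq0 => /eqP.
Qed.

Lemma dist_integral_lower_bound : (2 * E - 1) / (4 * E ^+ 2) * L ^+ 3 <= W.
Proof.
apply: le_trans W_ge; rewrite power_sums lerDl divr_ge0//.
by apply: sumr_ge0 => e _; case: (gap_ge0 e).
Qed.

Let tight_loop : W <= L * S2 / 2 - S3 / 4 -> forall e, src e = tgt e.
Proof.
move=> Wle e.
have DE f s : 0 <= s <= len f -> S2 / 4 + (L - len f) * end_dist (len f) s
    = dist_integral [set: edge G]%SET (pt f s).
  apply: (@sum_itg_eq _ _ [set: edge G]%SET (fun f s => S2 / 4 + (L - len f) * end_dist (len f) s)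
     (fun f s => dist_integral [set: edge G]%SET (pt f s))) => //.
  - exact: dist_integral_continuous.
  - rewrite [leRHS](eq_bigl xpredT) => [|i]; last by rewrite inE.
    by rewrite sum_lowD; exact: Wle.
have dE s t : 0 < s < len e -> 0 <= t <= len e -> circle_dist (len e) s t = dist (pt e s) (pt e t).
  move=> hs ht; have hs' : 0 <= s <= len e by case/andP: hs => ? ?; rewrite !ltW.
  have <- : low e s e t = circle_dist (len e) s t by rewrite /low eqxx.
  apply: (@sum_itg_eq _ _ [set: edge G]%SET (low e s) (fun f t => dist (pt e s) (pt f t))) => //.
  - by move=> f; apply: dist_continuous; exact: points_pt.
  - by move=> f u; exact: low_le.
  - rewrite [leRHS](eq_bigl xpredT) => [|i]; last by rewrite inE.
    by rewrite -/(lowD e s) lowDE// DE.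
have l0 := len_gt0 e.
have [] : @inl (vert G) (edge G * R) (src e) = inl (tgt e); last by [].
apply: dist_eq0 => //; apply/eqP; rewrite eq_le dist_ge0// andbT.
apply/ler_addgt0Pr => eps eps0; rewrite add0r.
pose s := Num.min (eps / 2) (len e / 2).
have s0 : 0 < s by rewrite lt_min !divr_gt0.
have sl : s <= len e / 2 by rewrite ge_min lexx orbT.
have se : s <= eps / 2 by rewrite ge_min lexx.
have hs : 0 < s < len e by rewrite s0/=; lra.
have := dE s (len e) hs; rewrite lexx ltW// => /(_ isT).
rewrite /circle_dist ler0_norm; last lra.
rewrite (min_idPr _); last lra.
have := @dist_tri _ _ (pt e 0) (pt e s) (pt e (len e)) (points_pt _ _)
   (points_pt _ _) (points_pt _ _).
have := dist_edge e 0 s; rewrite ler0_norm; last lra.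
by rewrite [pt e 0]pt_src// [pt e (len e)]pt_tgt//; lra.
Qed.

Let flower_tight : flower_graph G -> W <= L * S2 / 2 - S3 / 4.
Proof.
move=> [V1 loops].
have Veq (u v : vert G) : u = v.
  by have /fintype1P[w wP] : #|vert G| == 1%N; [rewrite V1|rewrite (wP u) (wP v)].
have ed e s v : 0 < s < len e -> dist (pt e s) (inl v) <= end_dist (len e) s.
  move=> /andP[s0 sl]; rewrite /end_dist le_min.
  have := dist_edge e s 0; have := dist_edge e s (len e).
  rewrite [pt e 0]pt_src// [pt e (len e)]pt_tgt// (Veq (src e) v) (Veq (tgt e) v).
  by rewrite subr0 (gtr0_norm s0) ltr0_norm ?subr_lt0// opprB => -> ->.
have le_low e s f t : 0 < s < len e -> 0 < t < len f -> dist (pt e s) (pt f t) <= low e s f t.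
  move=> hs ht; have ps := points_pt e s; have pt' := points_pt f t.
  rewrite /low; case: eqP => [fe|_]; last first.
    apply: le_trans (dist_tri ps (I : points (inl (src e) : rawpoint G)) pt') _.
    by apply: lerD; [exact: ed|rewrite dist_sym//; exact: ed].
  subst f; rewrite /circle_dist le_min dist_edge/=.
  have h1 := ed e s (src e) hs; have h2 := ed e t (src e) ht.
  have := dist_tri ps (I : points (inl (src e) : rawpoint G)) pt'.
  rewrite (dist_sym (I : points (inl (src e) : rawpoint G)) pt') => h.
  apply: le_trans h _; apply: le_trans (lerD h1 h2) _.
  rewrite /end_dist; case: (leP s) => ?; case: (leP t) => ?; case: (leP 0 (s - t)) => h;
    rewrite ?(ger0_norm h) ?(ltr0_norm h); lra.
rewrite -sum_lowD /W /integral_on [leLHS](eq_bigl xpredT); last by move=> f; rewrite inE.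
apply: ler_sum => e _; apply: le_itg; [exact: dist_integral_continuous|exact: lowD_continuous|].
move=> s hs; rewrite -lowDE; last by case/andP: hs => ? ?; rewrite !ltW.
rewrite /dist_integral /integral_on [leLHS](eq_bigl xpredT); last by move=> f; rewrite inE.
apply: ler_sum => f _; apply: le_itg; [|exact: low_continuous|by move=> t; exact: le_low].
by apply: dist_continuous; exact: points_pt.
Qed.

Lemma dist_integral_lower_bound_eq :
  W = (2 * E - 1) / (4 * E ^+ 2) * L ^+ 3 <-> flower_graph G /\ equilateral G.
Proof.
have El0 : 0 < E by exact: lt_le_trans ltr01 E_ge1.
split=> [WE|[fl eq]].
  have gap0 : \sum_e gap e <= 0 by have := W_ge; rewrite power_sums WE; lra.
  have lenm e : len e = m.
    apply: (gap_ge0 e).2; have gs f : xpredT f -> 0 <= gap f by case: (gap_ge0 f).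
    by apply: (psumr_eq0P gs) => //; apply/eqP; rewrite eq_le gap0 sumr_ge0.
  split; last by move=> e f; rewrite !lenm.
  have loops : forall e, src e = tgt e.
    apply: tight_loop; rewrite power_sums WE lerDl divr_ge0//.
    by apply: sumr_ge0 => e _; case: (gap_ge0 e).
  split=> //; have /card_gt0P[e _] : (0 < #|edge G|)%N by rewrite -(ltr0n R).
  apply/eqP/fintype1P; exists (src e) => v.
  have /connectP[c cp ->] := @graph_connected R G (src e) v.
  elim: c (src e) cp => //= w c IH u /andP[/existsP[f fP] /IH ->].
  by case/orP: fP => /andP[/eqP <- /eqP <-]; rewrite loops.
apply/eqP; rewrite eq_le dist_integral_lower_bound andbT.
apply: le_trans (flower_tight fl) _; rewrite power_sums big1 ?mul0r ?addr0// => e _.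
suff lm : len e = m by rewrite /gap lm subrr expr0n mul0r.
rewrite /m /total_length (eq_bigr (fun=> len e)) => [|f _]; last exact: eq.
rewrite sumr_const -[in RHS]mulr_natr -/E mulfK// gt_eqF//.
Qed.

End LowerBound.

(** * The upper bound *)

Section Growth.
Context {R : realType} {G : metricGraph R}.
Implicit Types (x y : rawpoint G) (e f : edge G) (s t : R) (u v w : vert G).
Implicit Types (V : {set vert G}) (H : {set edge G}).

Lemma integral_onU1 H e (g : rawpoint G -> R) : e \notin H ->
  integral_on (e |: H) g = itg 0 (len e) (fun s => g (pt e s)) + integral_on H g.
Proof. by move=> eH; rewrite /integral_on big_setU1. Qed.

Lemma length_onU1 H e : e \notin H -> length_on (e |: H) = len e + length_on H.
Proof. by move=> eH; rewrite /length_on big_setU1. Qed.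

Definition endpoint e (b : bool) := if b then src e else tgt e.

Let from e (b : bool) s := if b then s else len e - s.

Lemma dist_endpoint e b s : 0 <= s <= len e ->
  dist (pt e s) (inl (endpoint e b)) <= from e b s.
Proof.
move=> /andP[s0 sl]; rewrite /endpoint /from; case: b.
  by have := dist_edge e s 0; rewrite [pt e 0]pt_src// subr0 ger0_norm.
have := dist_edge e s (len e); rewrite [pt e (len e)]pt_tgt// ler0_norm ?subr_le0//.
by rewrite opprB.
Qed.

Let from_continuous e b : continuous (from e b).
Proof.
rewrite /from; case: b; first by move=> x; exact: cvg_id.
by apply: continuous_addr; [exact: cst_continuous|apply: continuous_oppr => x; exact: cvg_id].
Qed.

Let itg_from e b : itg 0 (len e) (from e b) = len e ^+ 2 / 2.
Proof.
have l0 := ltW (len_gt0 e); rewrite /from; case: b.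
  by rewrite itg_id//; field.
rewrite itgB ?itg_cst ?itg_id//; [by field|exact: cst_continuous|by move=> x; exact: cvg_id].
Qed.

Let self e s := s ^+ 2 - len e * s + len e ^+ 2 / 2.

Let self_continuous e : continuous (self e).
Proof.
apply: continuous_addr; last exact: cst_continuous.
apply: continuous_addr; first exact: exprn_continuous.
by apply: continuous_oppr => x; apply: cvgMr; exact: cvg_id.
Qed.

Let dist_self e s : 0 <= s <= len e ->
  itg 0 (len e) (fun t => dist (pt e s) (pt e t)) <= self e s.
Proof.
move=> /andP[s0 sl]; have l0 := ltW (len_gt0 e).
apply: le_trans (_ : itg 0 (len e) (fun t => `|t - s|) <= _).
  apply: le_itg; [|exact: continuous_dist|by move=> t _; rewrite distrC; exact: dist_edge].
  by apply: dist_continuous; exact: points_pt.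
rewrite itg_dist// sub0r normrN (ger0_norm s0) ger0_norm ?subr_ge0// /self.
by rewrite le_eqVlt; apply/orP; left; apply/eqP; field.
Qed.

Let itg_self e : itg 0 (len e) (self e) = len e ^+ 3 / 3.
Proof.
have l0 := ltW (len_gt0 e).
have ci : continuous (fun x : R => len e * x) by move=> x; apply: cvgMr; exact: cvg_id.
have cs : continuous (fun x : R => x ^+ 2) by exact: exprn_continuous.
rewrite /self itgD; last 2 first.
- by apply: continuous_addr => //; exact: continuous_oppr.
- exact: cst_continuous.
rewrite itg_cst// itgB// itg_sqr// itgZ ?itg_id//; first by field.
by move=> x; exact: cvg_id.
Qed.

Let cross_edge H e b s : 0 <= s <= len e ->
  dist_integral H (pt e s) <=
    dist_integral H (inl (endpoint e b)) + from e b s * length_on H.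
Proof.
move=> hs; have := dist_integral_lip H (points_pt e s)
  (I : points (inl (endpoint e b) : rawpoint G)).
rewrite ler_norml => /andP[_]; rewrite lerBlDl => h; apply: le_trans h _.
by rewrite lerD2l mulrC ler_wpM2r ?length_on_ge0// dist_endpoint.
Qed.

Definition grown V H := [/\ forall e b, e \in H -> endpoint e b \in V,
  forall u v, u \in V -> v \in V -> dist (inl u : rawpoint G) (inl v) <= length_on H,
  forall u, u \in V -> dist_integral H (inl u) <= length_on H ^+ 2 / 2
  & integral_on H (dist_integral H) <= length_on H ^+ 3 / 3].

Section Step.
Context (V : {set vert G}) (H : {set edge G}) (e : edge G) (b : bool).
Context (VH : grown V H) (eH : e \notin H) (eV : endpoint e b \in V).

Let l := len e.
Let v : rawpoint G := inl (endpoint e b).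

Let itg_edge x : points x ->
  itg 0 l (fun s => dist x (pt e s)) <= l * dist x v + l ^+ 2 / 2.
Proof.
move=> px; have l0 := ltW (len_gt0 e).
rewrite -(itg_from e b) mulrC -{2}[l]subr0 -(itg_cst _ l0) -itgD//; last exact: cst_continuous.
apply: le_itg; [exact: dist_continuous|by apply: continuous_addr => //; exact: cst_continuous|].
move=> s /andP[s0 sl]; apply: le_trans (dist_tri px (I : points v) (points_pt e s)) _.
rewrite lerD2l dist_sym//; last exact: points_pt.
by apply: dist_endpoint; rewrite !ltW.
Qed.

Let old_new : integral_on H (dist_integral (e |: H)) <=
  length_on H ^+ 3 / 3 + (l * dist_integral H v + l ^+ 2 / 2 * length_on H).
Proof.
case: VH => _ _ _ WH.
have cD := @dist_integral_continuous _ G H.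
have cI : gcontinuous (fun x => itg 0 l (fun s => dist x (pt e s))).
  have E1 : (fun x => itg 0 l (fun s => dist x (pt e s))) = dist_integral [set e]%SET.
    by apply/funext => x; rewrite /dist_integral /integral_on big_set1.
  by rewrite E1; exact: dist_integral_continuous.
rewrite (_ : integral_on H _ = integral_on H (dist_integral H) +
    integral_on H (fun x => itg 0 l (fun s => dist x (pt e s)))); last first.
  rewrite -integral_onD//; apply: eq_bigr => f _; apply: eq_itg => s _.
  by rewrite /dist_integral integral_onU1// addrC.
apply: lerD => //.
rewrite -integral_on_cst -integral_onZ; last exact: dist_continuous.
rewrite -integral_onD; last 2 first.
- by move=> f s; apply: cvgMr; exact: (dist_continuous (I : points v)).
- exact: gcontinuous_cst.
apply: le_integral_on => //.
  by apply: gcontinuousD; [move=> f s; apply: cvgMr; exact: (dist_continuous (I : points v))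
    |exact: gcontinuous_cst].
by move=> x px; rewrite (dist_sym (I : points v) px); exact: itg_edge.
Qed.

Let bound s := dist_integral H v + from e b s * length_on H + self e s.

Let bound_continuous : continuous bound.
Proof.
apply: continuous_addr => //; apply: continuous_addr; first exact: cst_continuous.
by move=> x; apply: cvgMl; exact: from_continuous.
Qed.

Let new_le s : 0 <= s <= l -> dist_integral (e |: H) (pt e s) <= bound s.
Proof.
move=> hs; rewrite {1}/dist_integral integral_onU1// addrC.
by apply: lerD; [exact: cross_edge|exact: dist_self].
Qed.

Let itg_bound : itg 0 l bound = l * dist_integral H v + l ^+ 2 / 2 * length_on H + l ^+ 3 / 3.
Proof.
have l0 := ltW (len_gt0 e); have cf := @from_continuous e b.
have cc : continuous (fun s => length_on H * from e b s) by move=> x; apply: cvgMr; exact: cf.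
rewrite /bound (@eq_itg _ _ _ _ (fun s =>
    (dist_integral H v + length_on H * from e b s) + self e s)).
  rewrite itgD//; last by apply: continuous_addr => //; exact: cst_continuous.
  rewrite itgD//; last exact: cst_continuous.
  by rewrite itg_cst// itgZ// itg_from itg_self subr0 -/l; ring.
by move=> s _; rewrite [from _ _ _ * _]mulrC.
Qed.

Let new_new : itg 0 l (fun s => dist_integral (e |: H) (pt e s)) <= itg 0 l bound.
Proof.
apply: le_itg => //; first exact: dist_integral_continuous.
by move=> s /andP[s0 sl]; apply: new_le; rewrite !ltW.
Qed.

Let Dv : dist_integral H v <= length_on H ^+ 2 / 2.
Proof. by case: VH => _ _ h _; exact: h. Qed.

Lemma grown_step : grown (endpoint e (~~ b) |: V) (e |: H).
Proof.
case: (VH) => HV dV DV WH; have l0 : 0 < l := len_gt0 e; have H0 := @length_on_ge0 _ G H.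
have vw : dist (inl (endpoint e (~~ b)) : rawpoint G) v <= l.
  have -> : inl (endpoint e (~~ b)) = pt e (from e b l).
    by rewrite /endpoint /from /l; case: b => /=; [rewrite pt_tgt|rewrite subrr pt_src].
  apply: le_trans (dist_endpoint _ _) _.
    by rewrite /from -/l; case: b; apply/andP; split; lra.
  by rewrite /from -/l; case: b; lra.
have dw u : u \in V -> dist (inl u : rawpoint G) (inl (endpoint e (~~ b))) <= l + length_on H.
  move=> uV; have := @dist_tri _ G (inl u) v (inl (endpoint e (~~ b))) I I I.
  by rewrite (dist_sym (I : points v)) //; have := dV u _ uV eV; rewrite /v; lra.
have Dw : dist_integral H (inl (endpoint e (~~ b))) <= dist_integral H v + length_on H * l.
  have := dist_integral_lip H (I : points (inl (endpoint e (~~ b)) : rawpoint G)) (I : points v).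
  rewrite ler_norml => /andP[_] h; have := ler_wpM2l H0 vw; lra.
split.
- move=> f c; rewrite !inE => /predU1P[->|fH]; last by rewrite HV ?orbT.
  have [->|cb] := eqVneq c b; first by rewrite eV orbT.
  by have -> : c = ~~ b; [move: cb; case: c; case: b|rewrite eqxx].
- rewrite length_onU1// -/l => u1 u2; rewrite !inE => /predU1P[->|u1V] /predU1P[->|u2V].
  + by rewrite dist_xx//; rewrite -/l; lra.
  + by rewrite dist_sym//; exact: dw.
  + exact: dw.
  + by have := dV _ _ u1V u2V; lra.
- move=> u; rewrite /dist_integral integral_onU1// length_onU1// !inE -/l.
  move=> /predU1P[->|uV]; last first.
    have := @itg_edge (inl u) I; have := DV u uV; have := ler_wpM2l (ltW l0) (dV u _ uV eV).
    by rewrite -/l -/v /dist_integral; nra.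
  have : itg 0 l (fun s => dist (inl (endpoint e (~~ b))) (pt e s)) <= l ^+ 2 / 2.
    rewrite -(itg_from e (~~ b)); apply: le_itg => //; first exact: dist_continuous.
    move=> s /andP[s0 sl]; rewrite dist_sym//; last exact: points_pt.
    by apply: dist_endpoint; rewrite !ltW.
  by move: Dw Dv; rewrite /dist_integral; nra.
- rewrite integral_onU1// length_onU1// -/l.
  have := ler_wpM2l (ltW l0) Dv; have := old_new; have := new_new; rewrite itg_bound -/l.
  by move: (length_on H) (dist_integral H v) => h d; nra.
Qed.

(* If the cubic bound is attained, then so is the bound of every single step,
   in particular at the new endpoint of e. *)
Lemma grown_step_eq :
  length_on (e |: H) ^+ 3 / 3 <= integral_on (e |: H) (dist_integral (e |: H)) ->
  dist_integral (e |: H) (inl (endpoint e (~~ b))) = length_on (e |: H) ^+ 2 / 2.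
Proof.
rewrite integral_onU1// length_onU1// -/l => Wge.
have l0 : 0 < l := len_gt0 e; have H0 := @length_on_ge0 _ G H.
have on := old_new; have nn := new_new; have := itg_bound => ib.
have Dv_eq : dist_integral H v = length_on H ^+ 2 / 2.
  apply/eqP; rewrite eq_le Dv/= -(ler_pM2l l0).
  by move: Wge on nn; rewrite ib; move: (length_on H) (dist_integral H v) => h d; lra.
have -> : inl (endpoint e (~~ b)) = pt e (from e b l).
  by rewrite /endpoint /from /l; case: b => /=; [rewrite pt_tgt|rewrite subrr pt_src].
have hl : 0 <= from e b l <= l.
  by rewrite /from /l; case: b; rewrite ?subrr ?lexx ltW.
rewrite (@continuous_eq_itg _ 0 l (fun s => dist_integral (e |: H) (pt e s)) bound)//.
- by rewrite /bound Dv_eq /self /from -/l; case: b; field.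
- exact: dist_integral_continuous.
apply: itg_eq_le => //; first exact: dist_integral_continuous.
  by move=> s /andP[s0 sl]; apply: new_le; rewrite !ltW.
by move: Wge on Dv_eq; rewrite ib; move: (length_on H) (dist_integral H v) => h d; nra.
Qed.

End Step.

Lemma grown_extend V H v0 : grown V H -> v0 \in V -> H != [set: edge G]%SET ->
  exists e b, e \notin H /\ endpoint e b \in V.
Proof.
move=> [HV _ _ _] v0V HT; apply: contrapT => no.
have stay e b : endpoint e b \in V -> e \in H.
  by move=> eV; apply: contraT => eH; case: no; exists e, b.
have VT u : u \in V.
  rewrite -(closed_connect _ (@graph_connected R G v0 u))// => a c /existsP[f fac].
  have sc bb : endpoint f bb \in V -> forall cc, endpoint f cc \in V.
    by move=> /stay fH cc; exact: HV.
  by apply/idP/idP; case/orP: fac => /andP[/eqP <- /eqP <-] h;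
    first [exact: (sc true h false)|exact: (sc false h true)].
case/negP: HT; apply/eqP/setP => e; rewrite inE; apply: (stay e true); exact: VT.
Qed.

Lemma grown_exists v0 n : (n <= #|edge G|)%N ->
  exists V H, [/\ grown V H, v0 \in V & #|H| = n].
Proof.
elim: n => [_|n IH nE].
  exists [set v0]%SET, finset.set0; rewrite cards0 inE; split=> //.
  split=> [e b|u v|u|]; rewrite ?inE// /length_on /dist_integral /integral_on big_set0.
  - by move=> /eqP-> /eqP->; rewrite dist_xx.
  - by rewrite big_set0 expr0n mul0r.
  - by rewrite big_set0 expr0n mul0r.
have [V [H [VH v0V Hn]]] := IH (ltnW nE).
have HT : H != [set: edge G]%SET.
  by apply: contraL nE => /eqP HT; rewrite -leqNgt -Hn HT cardsT.
have [e [b [eH eV]]] := grown_extend VH v0V HT.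
exists (endpoint e (~~ b) |: V), (e |: H); split; first exact: grown_step.
  by rewrite !inE v0V orbT.
by rewrite cardsU1 eH Hn.
Qed.

Local Notation L := (total_length G).
Local Notation ET := [set: edge G]%SET.

Lemma dist_integral_upper_bound (L0 : 0 < L) :
  integral_on ET (dist_integral ET) <= L ^+ 3 / 3 /\
  (L ^+ 3 / 3 <= integral_on ET (dist_integral ET) ->
    exists w, dist_integral ET (inl w) = L ^+ 2 / 2).
Proof.
have E0 := card_edge_gt0 L0; have /card_gt0P[e0 _] := E0.
have [V [H [VH v0V Hn]]] := @grown_exists (src e0) #|edge G|.-1 (leq_pred _).
have HT : H != ET.
  by apply/eqP => HT; move: Hn; rewrite HT cardsT -{1}(prednK E0) => /esym/n_Sn.
have [e [b [eH eV]]] := grown_extend VH v0V HT.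
have eHT : e |: H = ET.
  by apply/eqP; rewrite eqEcard finset.subsetT cardsU1 eH Hn add1n prednK// cardsT leqnn.
have := grown_step VH eH eV; have := grown_step_eq VH eH eV.
rewrite eHT total_lengthE => eq [_ _ _ le]; split=> // /eq h.
by exists (endpoint e (~~ b)).
Qed.

End Growth.

(** * Level sets of the distance and the coarea formula *)

Section Coarea.
Context {R : realType} {G : metricGraph R}.
Implicit Types (y z : rawpoint G) (e f : edge G) (s t r : R) (u v w : vert G).

Lemma points_on_edge (L0 : 0 < total_length G) y : points y ->
  exists e t, 0 <= t <= len e /\ y = pt e t.
Proof.
case: y => [v _|[e t] /= h]; last first.
  by exists e, t; rewrite pt_in//; case/andP: h => ? ?; rewrite !ltW.
have /card_gt0P[e0 _] := card_edge_gt0 L0.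
suff [e [->|->]] : exists e, v = src e \/ v = tgt e.
- by exists e, 0; rewrite lexx ltW ?len_gt0// pt_src.
- by exists e, (len e); rewrite lexx ltW ?len_gt0// pt_tgt.
have /connectP[[|w c] cp E] := @graph_connected R G v (src e0).
  by exists e0; left.
move: cp => /= /andP[/existsP[e /orP[]/andP[/eqP h1 /eqP h2]] _]; exists e.
  by left.
by right.
Qed.

Context (L0 : 0 < total_length G) (x : rawpoint G) (px : points x).

Definition at_level r (S : seq (rawpoint G)) :=
  uniq S /\ forall z, z \in S -> points z /\ dist x z = r.

(* Each edge is cut at x (if x lies inside it) into pieces (e, b); on a piece,
   the distance to x increases from both ends up to a common level. The third
   boolean selects one of these two monotone halves. *)
Let half := (edge G * (bool * bool))%type.
Implicit Types (i j : half).

Let cut e := if x is inr (e', s) then if e' == e then s else 0 else 0.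

Let cut_itv e : 0 <= cut e <= len e.
Proof.
rewrite /cut; case: x px => [v _|[e' s] /= /andP[s0 sl]]; first by rewrite lexx ltW ?len_gt0.
by case: eqP => [<-|_]; rewrite ?lexx ?ltW ?len_gt0.
Qed.

Let lo (p : edge G * bool) := if p.2 then cut p.1 else 0.
Let hi (p : edge G * bool) := if p.2 then len p.1 else cut p.1.
Let glo p := dist x (pt p.1 (lo p)).
Let ghi p := dist x (pt p.1 (hi p)).
Let mid p := (glo p + ghi p + (hi p - lo p)) / 2.

Let lo_hi p : [/\ 0 <= lo p, lo p <= hi p & hi p <= len p.1].
Proof. by rewrite /lo /hi; have /andP[? ?] := cut_itv p.1; case: p.2. Qed.

Let glo_ghi p : [/\ 0 <= glo p, 0 <= ghi p, glo p <= mid p & ghi p <= mid p].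
Proof.
have [_ lh _] := lo_hi p; have := dist_lip p.1 (lo p) (hi p) px.
rewrite -/(glo p) -/(ghi p) (ler0_norm (_ : lo p - hi p <= 0)) ?subr_le0//.
rewrite ler_norml => /andP[? ?].
by rewrite /mid !dist_ge0//; try exact: points_pt; split => //; lra.
Qed.

Let piece p t : lo p <= t <= hi p ->
  dist x (pt p.1 t) = Num.min (glo p + (t - lo p)) (ghi p + (hi p - t)).
Proof.
case: p => e b; have := glo_ghi (e, b); rewrite /glo /ghi /mid /lo /hi /cut /=.
have out : (forall c, x <> inr (e, c)) -> (if b then 0 else 0) <= t <= (if b then len e else 0) ->
    dist x (pt e t) = Num.min (dist x (pt e (if b then 0 else 0)) + (t - (if b then 0 else 0)))
      (dist x (pt e (if b then len e else 0)) + ((if b then len e else 0) - t)).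
  case: b => xe ht.
    by rewrite dist_outside// [pt e 0]pt_src// [pt e (len e)]pt_tgt// subr0.
  have -> : t = 0 by apply/eqP; rewrite eq_le andbC.
  by rewrite subrr addr0 minxx.
case: x px out => [v pv out _|[e' c] /= hc]; first by apply: out.
case: eqP => [ee|ne] out; last first.
  by move=> _; apply: out => c' [] /ne.
subst e'; have := hc; case/andP => c0 cl {out}.
rewrite -(pt_in hc); set X := pt e c => H ht.
have pX : points X := points_pt e c.
have A0 := @dist_ge0 _ _ X (inl (src e)) pX I.
have B0 := @dist_ge0 _ _ X (inl (tgt e)) pX I.
case: b H ht => H /andP[t1 t2].
  rewrite dist_inside//; last by rewrite t2 (le_trans (ltW c0)).
  rewrite dist_xx// add0r [pt e (len e)]pt_tgt// ger0_norm ?subr_ge0//.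
  rewrite [in LHS]minA (min_idPl (_ : t - c <= _))//; lra.
rewrite dist_inside//; last by rewrite t1 (le_trans t2 (ltW cl)).
rewrite dist_xx// add0r [pt e 0]pt_src// ler0_norm ?subr_le0// subr0 opprB.
rewrite [X in Num.min _ X]minC minA (min_idPl (_ : c - t <= _)) 1?minC//; lra.
Qed.

Let pc i := (i.1, i.2.1).
Let bot i := if i.2.2 then ghi (pc i) else glo (pc i).
Let top i := mid (pc i).
Let pos i r := if i.2.2 then hi (pc i) - (r - bot i) else lo (pc i) + (r - bot i).

Let bot_top i : 0 <= bot i <= top i.
Proof. by rewrite /bot /top; have [? ? ? ?] := glo_ghi (pc i); case: i.2.2; apply/andP. Qed.

Let pos_itv i r : bot i <= r <= top i -> lo (pc i) <= pos i r <= hi (pc i).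
Proof.
rewrite /pos /bot /top /mid; have := glo_ghi (pc i); rewrite /mid => -[g0 g1 g2 g3].
by case: i.2.2 => /andP[? ?]; apply/andP; split; lra.
Qed.

Let pos_level i r : bot i <= r <= top i -> dist x (pt i.1 (pos i r)) = r.
Proof.
move=> h; rewrite (@piece (pc i)) ?pos_itv//.
move: h; rewrite /pos /bot /top /mid; have := glo_ghi (pc i); rewrite /mid => -[g0 g1 g2 g3].
case: i.2.2 => /andP[h1 h2].
  by rewrite (min_idPr _); lra.
by rewrite (min_idPl _); lra.
Qed.

Let level_pos e t r : 0 <= t <= len e -> dist x (pt e t) = r ->
  exists i, [/\ i.1 = e, bot i <= r, r <= top i & t = pos i r].
Proof.
move=> /andP[t0 tl] dr; pose b := cut e <= t.
have ht : lo (e, b) <= t <= hi (e, b).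
  by rewrite /lo /hi /= /b; case: (leP (cut e) t) => h; rewrite ?h ?t0 ?tl// ltW.
have := piece ht; rewrite /= dr; case/andP: ht => h1 h2.
have := glo_ghi (e, b) => -[_ _ g1 g2].
case: leP => h E; [exists (e, (b, false))|exists (e, (b, true))];
  rewrite /bot /pos /top /bot /pc /=; split=> //; move: g1 g2; rewrite /mid; lra.
Qed.

Let A := [seq (bot i, top i) | i <- enum {: half}].
Let X := [seq bot i | i <- enum {: half}] ++ [seq top i | i <- enum {: half}].

Let notinX r i : r \notin X -> r != bot i /\ r != top i.
Proof.
rewrite mem_cat negb_or => /andP[h1 h2]; split.
  by apply: contraNneq h1 => ->; apply: map_f; rewrite mem_enum.
by apply: contraNneq h2 => ->; apply: map_f; rewrite mem_enum.
Qed.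

Let count_A r : count (inside r) A = size [seq i <- enum {: half} | inside r (bot i, top i)].
Proof. by rewrite count_map size_filter. Qed.

Let count_ge r S : r \notin X -> at_level r S -> (size S <= count (inside r) A)%N.
Proof.
move=> rX [uS HS]; rewrite count_A -(size_map (fun i => pt i.1 (pos i r))).
apply: uniq_leq_size => // z /HS[pz dz].
have [e [t [ht zE]]] := points_on_edge L0 pz.
have [|i [ie h1 h2 tE]] := @level_pos e t r ht; first by rewrite -zE.
have [n1 n2] := notinX i rX.
apply/mapP; exists i; last by rewrite zE ie tE.
by rewrite mem_filter mem_enum andbT /inside/= !lt_neqAle h1 h2 eq_sym n1 n2.
Qed.

Let count_le r k : r \notin X -> (forall S, at_level r S -> (size S <= k)%N) ->
  (count (inside r) A <= k)%N.
Proof.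
move=> rX H; rewrite count_A -(size_map (fun i => pt i.1 (pos i r))).
apply: H; split; last first.
  move=> z /mapP[i]; rewrite mem_filter => /andP[/andP[/= h1 h2] _] ->.
  by split; [exact: points_pt|rewrite pos_level// !ltW].
rewrite map_inj_in_uniq; first exact/filter_uniq/enum_uniq.
move=> i j.
rewrite !mem_filter => /andP[/andP[/= i1 i2] _] /andP[/andP[/= j1 j2] _] E.
have i12 : bot i <= r <= top i by rewrite !ltW.
have j12 : bot j <= r <= top j by rewrite !ltW.
have /andP[hi1 hi2] := pos_itv i12; have /andP[hj1 hj2] := pos_itv j12.
have [i0 _ il] := lo_hi (pc i); have [j0 _ jl] := lo_hi (pc j).
have interior (h : half) : bot h < r -> r < top h -> 0 <= pos h r -> pos h r <= len h.1 ->
    0 < pos h r < len h.1.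
  move=> k1 k2 p0 pl; have dk : dist x (pt h.1 (pos h r)) = r by apply: pos_level; rewrite !ltW.
  rewrite !lt_neqAle p0 pl !andbT; apply/andP; split; apply/eqP => P.
  - have [+ _] := notinX (h.1, (false, false)) rX.
    by rewrite /bot /glo /lo /pc/= P dk eqxx.
  - have [+ _] := notinX (h.1, (true, true)) rX.
    by rewrite /bot /ghi /hi /pc/= -P dk eqxx.
have ii := interior i i1 i2 (le_trans i0 hi1) (le_trans hi2 il).
have jj := interior j j1 j2 (le_trans j0 hj1) (le_trans hj2 jl).
move: E; rewrite !pt_in// => -[e12 pos12].
have di := pos_level i12.
have cutX e : dist x (pt e (cut e)) != r.
  by have [+ _] := notinX (e, (true, false)) rX; rewrite /bot /glo /lo /pc /= eq_sym.
have bb : i.2.1 = j.2.1.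
  apply/eqP; apply: contraT => nb; have tc : pos i r = cut i.1.
    move: hi1 hi2 hj1 hj2; rewrite -pos12 /lo /hi /pc /= -e12.
    by case: (i.2.1) nb; case: (j.2.1) => //= _ *; apply/eqP; rewrite eq_le; apply/andP.
  by have := cutX i.1; rewrite -tc di eqxx.
have pcE : pc i = pc j by rewrite /pc e12 bb.
have gg : i.2.2 = j.2.2.
  apply/eqP; apply: contraT => ng; have [_ /eqP nt] := notinX i rX; case: nt.
  move: pos12; rewrite /top /pos /bot /mid -pcE.
  by case: (i.2.2) ng; case: (j.2.2) => //= _; lra.
by move: e12 bb gg; case: (i) => ? [? ?]; case: (j) => ? [? ?] /= -> -> ->.
Qed.

Let A_itv M : (forall z, points z -> dist x z <= M) ->
  forall p, p \in A -> [/\ 0 <= p.1, p.1 <= p.2 & p.2 <= M].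
Proof.
move=> HM p /mapP[i _ ->] /=; have /andP[b0 bt] := bot_top i; split=> //.
by rewrite -(@pos_level i (top i)) ?bt ?lexx//; apply: HM; exact: points_pt.
Qed.

Let coarea (psi Psi : R -> R) : continuous psi ->
  (forall r : R, is_derive r (1 : R) Psi (psi r)) ->
  integral_on [set: edge G]%SET (psi \o dist x) = increments Psi A.
Proof.
move=> cpsi dPsi; rewrite /increments big_map big_enum/= -(pair_bigA _ (fun e b =>
  Psi (top (e, b)) - Psi (bot (e, b))))/= /integral_on.
apply: eq_big => [e|e _]; first by rewrite inE.
have cg : continuous (fun s => psi (dist x (pt e s))).
  by move=> s; apply: continuous_comp; [exact: dist_continuous|exact: cpsi].
rewrite (itg_split cg (cut_itv e)) -(pair_bigA _ (fun b c =>
  Psi (top (e, (b, c))) - Psi (bot (e, (b, c)))))/=.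
have half_up a b k : a <= b ->
    itg a b (fun s => psi (s + k)) = Psi (b + k) - Psi (a + k).
  move=> ab; have dF (s : R) : is_derive s (1 : R) (fun s => Psi (s + k)) (psi (s + k)).
    have := @is_derive1_comp _ Psi (fun s => s + k) s (psi (s + k)) 1 (dPsi _).
    by rewrite mulr1; apply; apply: is_derive_eq; rewrite addr0.
  rewrite (itg_FTC ab _ dF)// => s.
  by apply: continuous_comp; [apply: cvgD; [exact: cvg_id|exact: cvg_cst]|exact: cpsi].
have half_down a b k : a <= b ->
    itg a b (fun s => psi (k - s)) = Psi (k - a) - Psi (k - b).
  move=> ab; have dF (s : R) : is_derive s (1 : R) (fun s => - Psi (k - s)) (psi (k - s)).
    have dk : is_derive s (1 : R) (fun s => k - s) (-1).
      by have := is_deriveB (is_derive_cst k s (1 : R)) (is_derive_id s (1 : R)); rewrite sub0r.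
    have dPk := dPsi (k - s); have := @is_derive1_comp _ Psi (fun s => k - s) s _ _ dPk dk.
    by move=> /is_deriveN; rewrite mulrN1 opprK.
  rewrite (itg_FTC ab _ dF); first by ring.
  by move=> s; apply: continuous_comp; [apply: cvgB; [exact: cvg_cst|exact: cvg_id]|exact: cpsi].
have one p : p.1 = e -> itg (lo p) (hi p) (fun s => psi (dist x (pt e s))) =
    (Psi (mid p) - Psi (glo p)) + (Psi (mid p) - Psi (ghi p)).
  move=> pe; have [l0 lh hl] := lo_hi p; have [g0 g1 g2 g3] := glo_ghi p.
  pose mu := lo p + (mid p - glo p).
  have mE : mu = hi p - (mid p - ghi p) by rewrite /mu /mid; field.
  have h1 : lo p <= mu by rewrite /mu; lra.
  have h2 : mu <= hi p by rewrite mE; lra.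
  rewrite (itg_split cg (c := mu)) ?h1//; congr (_ + _).
    rewrite (@eq_itg _ _ _ _ (fun s => psi (s + (glo p - lo p)))).
      by rewrite half_up//; congr (Psi _ - Psi _); rewrite /mu; ring.
    move=> s /andP[s1 s2]; congr psi; rewrite -pe piece; last by apply/andP; split; lra.
    by rewrite (min_idPl _); [ring|move: s2; rewrite mE; move: (mE); rewrite /mu; lra].
  rewrite (@eq_itg _ _ _ _ (fun s => psi ((ghi p + hi p) - s))).
    by rewrite half_down//; congr (Psi _ - Psi _); rewrite ?mE; ring.
  move=> s /andP[s1 s2]; congr psi; rewrite -pe piece; last by apply/andP; split; lra.
  by rewrite (min_idPr _); [ring|move: s1; rewrite mE; move: (mE); rewrite /mu; lra].
have := one (e, false) erefl; have := one (e, true) erefl.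
rewrite /lo /hi /= => -> ->; rewrite !big_bool /= /top /bot /pc /=; ring.
Qed.

Lemma integral_dist_ge (B : seq (R * R)) (Y : seq R) M (psi Psi : R -> R) : continuous psi ->
  (forall r : R, is_derive r (1 : R) Psi (psi r)) ->
  (forall z, points z -> dist x z <= M) ->
  (forall s t, 0 <= s -> s <= t -> t <= M -> Psi s <= Psi t) ->
  (forall p, p \in B -> [/\ 0 <= p.1, p.1 <= p.2 & p.2 <= M]) ->
  (forall r, 0 < r < M -> r \notin Y ->
    exists2 S, at_level r S & (count (inside r) B <= size S)%N) ->
  increments Psi B <= integral_on [set: edge G]%SET (psi \o dist x).
Proof.
move=> cpsi dPsi HM mF HB HS; rewrite (coarea cpsi dPsi).
have M0 : 0 <= M by rewrite -(dist_xx px) HM.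
apply: (@le_increments _ _ _ _ (X ++ Y) 0 M) => //.
  by move=> i; rewrite mem_cat => /orP[/(A_itv HM)|/HB].
move=> r hr; rewrite mem_cat negb_or => /andP[rX rY].
have [S LS cS] := HS r hr rY; exact: leq_trans cS (count_ge rX LS).
Qed.

Lemma integral_dist_le (B : seq (R * R)) (Y : seq R) M (psi Psi : R -> R) : continuous psi ->
  (forall r : R, is_derive r (1 : R) Psi (psi r)) ->
  (forall z, points z -> dist x z <= M) ->
  (forall s t, 0 <= s -> s <= t -> t <= M -> Psi s <= Psi t) ->
  (forall p, p \in B -> [/\ 0 <= p.1, p.1 <= p.2 & p.2 <= M]) ->
  (forall r, 0 < r < M -> r \notin Y ->
    forall S, at_level r S -> (size S <= count (inside r) B)%N) ->
  integral_on [set: edge G]%SET (psi \o dist x) <= increments Psi B.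
Proof.
move=> cpsi dPsi HM mF HB HS; rewrite (coarea cpsi dPsi).
have M0 : 0 <= M by rewrite -(dist_xx px) HM.
apply: (@le_increments _ _ _ _ (X ++ Y) 0 M) => //.
  by move=> i; rewrite mem_cat => /orP[/HB|/(A_itv HM)].
move=> r hr; rewrite mem_cat negb_or => /andP[rX rY].
by apply: count_le => // S; exact: HS.
Qed.

Lemma eccentricity : exists M,
  (forall z, points z -> dist x z <= M) /\ exists2 y, points y & dist x y = M.
Proof.
have [e0 _] := points_on_edge L0 px.
pose i0 : half := (e0, (true, true)).
have [i _ Hi] := @Order.TotalTheory.arg_maxP _ R half i0 xpredT top isT.
exists (top i); split=> [z pz|].
  have [e [t [ht ->]]] := points_on_edge L0 pz.
  have [j [_ _ h _]] := level_pos ht erefl; exact: le_trans h (Hi j isT).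
exists (pt i.1 (pos i (top i))); first exact: points_pt.
by rewrite pos_level// lexx andbT; case/andP: (bot_top i).
Qed.

End Coarea.

Section Levels.
Context {R : realType} {G : metricGraph R}.
Implicit Types (y z : rawpoint G) (e f : edge G) (s t r : R).
Local Notation L := (total_length G).
Local Notation ET := [set: edge G]%SET.
Context (L0 : 0 < L).

Lemma integral_on1 : integral_on ET (fun _ : rawpoint G => 1) = L.
Proof. by rewrite integral_on_cst mul1r -total_lengthE. Qed.

Lemma path_wf y z p (c : segment G) : is_path y p z -> c \in p -> seg_wf c.
Proof.
elim: p y => // c' p IH y [wf _ H].
by rewrite inE => /predU1P[->//|]; exact: IH H.
Qed.

Section Covering.
Context (x : rawpoint G) (px : points x) (M : R).
Context (HM : forall z, points z -> dist x z <= M).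

Definition covers k := exists Y : seq R, forall r, 0 < r < M -> r \notin Y ->
  exists2 S, at_level x r S & (k <= size S)%N.

Let M0 : 0 <= M. Proof. by rewrite -(dist_xx px) HM. Qed.

Let Psi r := M * r - r ^+ 2 / 2.

Let dPsi (r : R) : is_derive r (1 : R) Psi (M - r).
Proof. by apply: is_derive_eq; rewrite /GRing.scale/=; field. Qed.

Let cpsi : continuous (fun r => M - r).
Proof. by apply: continuous_addr; [exact: cst_continuous|apply: continuous_oppr => r; exact: cvg_id]. Qed.

Let Psi_mono s t : 0 <= s -> s <= t -> t <= M -> Psi s <= Psi t.
Proof. by rewrite /Psi => *; nra. Qed.

Let integral_psi : integral_on ET ((fun r => M - r) \o dist x) = M * L - dist_integral ET x.
Proof.
rewrite -integral_on1 -integral_onZ; last exact: gcontinuous_cst.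
rewrite /dist_integral -[X in _ - X]mul1r -mulNr -integral_onZ; last exact: dist_continuous.
rewrite -integral_onD; last 2 first.
- by move=> e; exact: cst_continuous.
- by move=> e s; apply: cvgMr; exact: (dist_continuous px).
by apply: eq_bigr => e _; apply: eq_itg => s _ /=; ring.
Qed.

Let count_nseq k r : 0 < r < M -> count (inside r) (nseq k (0, M)) = k.
Proof. by move=> h; rewrite count_nseq /inside /= h mul1n. Qed.

Let incr_nseq k : increments Psi (nseq k (0, M)) = k%:R * M ^+ 2 / 2.
Proof.
rewrite /increments; elim: k => [|k IH]; first by rewrite big_nil !mul0r.
by rewrite /= big_cons IH /Psi /= -addn1 natrD; field.
Qed.

Lemma dist_integral_le_ecc k : covers k ->
  dist_integral ET x <= M * L - k%:R * M ^+ 2 / 2.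
Proof.
move=> [Y HY]; have : increments Psi (nseq k (0, M)) <= M * L - dist_integral ET x.
  rewrite -integral_psi; apply: (integral_dist_ge L0 px (M := M) (Y := Y)) => //.
    by move=> p; rewrite mem_nseq => /andP[_ /eqP->] /=; rewrite lexx.
  by move=> r hr rY; rewrite count_nseq//; exact: HY.
by rewrite incr_nseq; lra.
Qed.

(* Sliding k + 1 points of a level set towards x keeps them apart for a while,
   so an oversized level set costs a definite amount in the bound above. *)
Lemma level_size_le k : covers k -> M * L - k%:R * M ^+ 2 / 2 <= dist_integral ET x ->
  forall r S, 0 < r -> at_level x r S -> (size S <= k)%N.
Proof.
move=> [Y HY] Dge r S r0 [uS HS]; rewrite leqNgt; apply/negP => kS.
have [z0 z0S] : exists z, z \in S by case: S kS {uS HS} => // z S _; exists z; rewrite inE eqxx.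
have rM : r <= M by have [pz <-] := HS z0 z0S; exact: HM.
have [a a0 aP] : exists2 a, 0 < a & forall ij : 'I_(size S) * 'I_(size S), ij.1 != ij.2 ->
    2 * a <= dist (nth z0 S ij.1) (nth z0 S ij.2).
  apply: (@finite_min _ _ (fun (ij : 'I_(size S) * 'I_(size S)) a => ij.1 != ij.2 ->
    2 * a <= dist (nth z0 S ij.1) (nth z0 S ij.2))) => [ij b c cb h /h|[i j]] /=; first lra.
  have [pi _] := HS _ (mem_nth z0 (ltn_ord i)); have [pj _] := HS _ (mem_nth z0 (ltn_ord j)).
  have [->|ij] := eqVneq i j; first by exists 1.
  have d0 : 0 < dist (nth z0 S i) (nth z0 S j).
    rewrite lt_neqAle dist_ge0// andbT eq_sym; apply/eqP => /(dist_eq0 pi pj)/eqP.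
    by rewrite nth_uniq// => h; move: ij; rewrite -val_eqE/= h.
  by exists (dist (nth z0 S i) (nth z0 S j) / 2); [exact: divr_gt0|move=> _; lra].
pose eps := Num.min a r.
have e0 : 0 < eps by rewrite lt_min a0.
have er : eps <= r by rewrite ge_min lexx orbT.
have ea : eps <= a by rewrite ge_min lexx.
have slide r' : r - eps < r' < r -> exists2 S', at_level x r' S' & (k.+1 <= size S')%N.
  move=> /andP[r1 r2].
  have /choice[f fP] : forall z, exists z', z \in S ->
      [/\ points z', dist x z' = r' & dist z' z = r - r'].
    move=> z; have [zS|zS] := boolP (z \in S); last by exists z.
    have [pz dz] := HS z zS; have [|z' [? ? d]] := dist_between px pz (t := r').
      by rewrite dz (ltW r2) andbT; lra.
    by exists z'; rewrite d dz.
  exists (map f S); last by rewrite size_map.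
  split; last by move=> _ /mapP[z /fP[? ? _] ->].
  rewrite map_inj_in_uniq// => u v uS' vS' fuv.
  have [pu _] := HS u uS'; have [pv _] := HS v vS'.
  have [pfu _ du] := fP u uS'; have [pfv _ dv] := fP v vS'.
  apply/eqP; apply: contraT => uv.
  have iu : (index u S < size S)%N by rewrite index_mem.
  have iv : (index v S < size S)%N by rewrite index_mem.
  have := aP (Ordinal iu, Ordinal iv); rewrite /= !nth_index// => /(_ _)/=.
  have := dist_tri pu pfu pv; rewrite (dist_sym pu pfu) {2}fuv du dv => h1 h2.
  suff ne : Ordinal iu != Ordinal iv by have := h2 ne; lra.
  by apply: contra uv => /eqP[]/(congr1 (nth z0 S)); rewrite !nth_index// => ->.
have : increments Psi ((r - eps, r) :: nseq k (0, M)) <= M * L - dist_integral ET x.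
  rewrite -integral_psi; apply: (integral_dist_ge L0 px (M := M) (Y := Y)) => //.
    move=> p; rewrite inE mem_nseq => /orP[/eqP->|/andP[_ /eqP->]] /=; last by rewrite lexx.
    by split => //; lra.
  move=> r' hr rY; rewrite /= count_nseq// /inside/=.
  case: (boolP (r - eps < r' < r)) => [/slide//|_]; exact: HY.
rewrite /increments big_cons -/(increments _ _) incr_nseq /Psi /=; nra.
Qed.

Lemma covers1 : (exists2 y, points y & dist x y = M) -> covers 1.
Proof.
move=> [y py dy]; exists [::] => r /andP[r0 rM] _.
have [|z [pz dz _]] := dist_between px py (t := r); first by rewrite dy !ltW.
by exists [:: z]; rewrite //; split=> // z'; rewrite inE => /eqP->.
Qed.

Lemma covers2 : doubly_connected G -> (exists2 y, points y & dist x y = M) -> covers 2.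
Proof.
move=> dc [y py dy]; have [p [q [xp xq pq]]] := dc x y px py.
pose lev p := [seq dist x (pt (seg_edge c) (seg_to c)) | c <- p].
exists (lev p ++ lev q) => r /andP[r0 rM]; rewrite mem_cat negb_or => /andP[rp rq].
have cross p' : is_path x p' y -> r \notin lev p' -> exists c s,
    [/\ c \in p', seg_interior c s, 0 < s < len (seg_edge c) & dist x (pt (seg_edge c) s) = r].
  move=> xp' rp'; have [||c [s [cp si ds]]] := path_cross (dist_continuous px) xp' (r := r).
  - by rewrite dist_xx// dy r0.
  - by move=> c cp E; case/negP: rp'; apply/mapP; exists c.
  exists c, s; split=> //.
  have := path_wf xp' cp.
  move=> [/andP[f0 fl] /andP[t0 tl]]; case/andP: si => s1 s2; apply/andP; split.
    by apply: le_lt_trans s1; rewrite le_min f0.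
  by apply: lt_le_trans s2 _; rewrite ge_max fl.
have [c [s [cp si hs ds]]] := cross p xp rp; have [c' [s' [cq si' hs' ds']]] := cross q xq rq.
exists [:: pt (seg_edge c) s; pt (seg_edge c') s'] => //; split; last first.
  by move=> z; rewrite !inE => /orP[]/eqP->; split=> //; exact: points_pt.
rewrite /= inE andbT !pt_in//; apply/eqP => -[ec ss].
rewrite ss in si; have : [set s'] `<=` seg_interior c `&` seg_interior c' by move=> _ ->.
by rewrite (pq c c' cp cq ec) => /(_ s' erefl).
Qed.

End Covering.

Lemma integral_dist_eq (x : rawpoint G) (B : seq (R * R)) (Y : seq R) M (psi Psi : R -> R) :
  points x -> continuous psi -> (forall r : R, is_derive r (1 : R) Psi (psi r)) ->
  (forall z, points z -> dist x z <= M) ->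
  (forall s t, 0 <= s -> s <= t -> t <= M -> Psi s <= Psi t) ->
  (forall p, p \in B -> [/\ 0 <= p.1, p.1 <= p.2 & p.2 <= M]) ->
  (forall r, 0 < r < M -> r \notin Y ->
    (exists2 S, at_level x r S & (count (inside r) B <= size S)%N) /\
    forall S, at_level x r S -> (size S <= count (inside r) B)%N) ->
  integral_on ET (psi \o dist x) = increments Psi B.
Proof.
move=> px cpsi dPsi HM mPsi HB H; apply/eqP; rewrite eq_le; apply/andP; split.
  by apply: (@integral_dist_le _ _ x px B Y M psi Psi) => // r hr rY; case: (H r hr rY).
by apply: (@integral_dist_ge _ _ L0 x px B Y M psi Psi) => // r hr rY; case: (H r hr rY).
Qed.

(** * Path graphs *)

Section PathGraph.

Lemma longest_path_graph w : points w -> dist_integral ET w = L ^+ 2 / 2 -> path_graph G.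
Proof.
move=> pw Dw; have [M [HM HMy]] := eccentricity L0 pw; have [y py dy] := HMy.
have c1 := covers1 pw HMy.
have := dist_integral_le_ecc pw HM c1; rewrite Dw mul1r => LM.
have ML : M = L.
  apply/eqP; rewrite -subr_eq0 -sqrf_eq0 eq_le sqr_ge0 andbT; nra.
have one := level_size_le pw HM c1.
have inj u v : points u -> points v -> dist w u = dist w v -> u = v.
  move=> pu pv E; have := dist_ge0 pw pu; rewrite le_eqVlt => /predU1P[d0|d0].
    by rewrite -(dist_eq0 pw pu (esym d0)) -(dist_eq0 pw pv _)// -E.
  apply/eqP; apply: contraT => uv.
  have : at_level w (dist w u) [:: u; v].
    split; first by rewrite /= inE uv.
    by move=> z; rewrite !inE => /orP[]/eqP->.
  have := one _ _ [:: u; v] d0; rewrite Dw ML mul1r => h /h /=; rewrite ltnn; apply; nra.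
have le u v : points u -> points v -> dist w u <= dist w v -> dist u v = dist w v - dist w u.
  move=> pu pv uv; have [|m [pm dm dmv]] := dist_between pw pv (t := dist w u).
    by rewrite dist_ge0.
  by rewrite -dmv (inj m u pm pu dm).
exists 0, L; split; first exact: ltW.
exists (dist w); split.
  split.
  - by move=> z pz /=; rewrite in_itv/= dist_ge0//= -ML HM.
  - by move=> u v /set_mem pu /set_mem pv; exact: inj.
  - move=> t /=; rewrite in_itv/= => ht; have [|z [pz dz _]] := dist_between pw py (t := t).
      by rewrite dy ML.
    by exists z.
move=> u v pu pv; case: (leP (dist w u) (dist w v)) => h.
  by rewrite /= ler0_norm ?subr_le0// opprB (le u v pu pv h).
by rewrite /= gtr0_norm ?subr_gt0// (dist_sym pu pv) (le v u pv pu (ltW h)).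
Qed.

Context (a b : R) (F : rawpoint G -> R) (ab : a <= b).
Context (Fbij : set_bij (@points R G) `[a, b] F).
Context (Fiso : forall y z, points y -> points z -> `|F y - F z| = dist y z).

Let Fin y : points y -> a <= F y <= b.
Proof. by case: Fbij => h _ _ /h /=; rewrite in_itv. Qed.

Let Finj y z : points y -> points z -> F y = F z -> y = z.
Proof. by case: Fbij => _ h _ py pz; apply: h; apply: mem_set. Qed.

Let Fsurj c : a <= c <= b -> exists2 y, points y & F y = c.
Proof. by case: Fbij => _ _ h hc; have [|y py <-] := h c; [rewrite /= in_itv|exists y]. Qed.

Lemma interval_integral (x : rawpoint G) (psi Psi : R -> R) : points x -> continuous psi ->
  (forall r : R, is_derive r (1 : R) Psi (psi r)) ->
  (forall s t, 0 <= s -> s <= t -> t <= b - a -> Psi s <= Psi t) ->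
  integral_on ET (psi \o dist x) =
    (Psi (F x - a) - Psi 0) + (Psi (b - F x) - Psi 0).
Proof.
move=> px cpsi dPsi mPsi; have /andP[ax xb] := Fin px; set c := F x in ax xb *.
pose M := Num.max (c - a) (b - c).
have Mab : M <= b - a by rewrite ge_max; apply/andP; split; lra.
rewrite (@integral_dist_eq x [:: (0, c - a); (0, b - c)] [:: c - a; b - c] M psi Psi)//.
- by rewrite /increments !big_cons big_nil addr0.
- move=> z pz; rewrite -Fiso// -/c; have /andP[? ?] := Fin pz.
  by rewrite /M le_max ler_norml ler_norml; case: (leP c (F z)) => h;
    apply/orP; [right|left]; apply/andP; split; lra.
- by move=> s t s0 st tM; apply: mPsi => //; exact: le_trans Mab.
- move=> p; rewrite !inE => /orP[]/eqP-> /=; rewrite subr_ge0 /M le_max ?ax ?xb !lexx ?orbT//.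
move=> r /andP[r0 rM]; rewrite !inE negb_or => /andP[r1 r2].
pose T : seq R := (if r < c - a then [:: c - r] else [::]) ++
  (if r < b - c then [:: c + r] else [::]).
have -> : count (inside r) [:: (0, c - a); (0, b - c)] = size T.
  by rewrite /= /inside/= r0 size_cat/= addn0; case: (r < c - a); case: (r < b - c).
have TP t : t \in T -> a <= t <= b /\ `|c - t| = r.
  rewrite mem_cat => /orP[].
    case: ltP => // h; rewrite inE => /eqP->; split; first by apply/andP; split; lra.
    by rewrite opprB addrCA subrr addr0 gtr0_norm.
  case: ltP => // h; rewrite inE => /eqP->; split; first by apply/andP; split; lra.
  by rewrite opprD addrA subrr sub0r normrN gtr0_norm.
have uT : uniq T.
  rewrite /T; case: ltP => // _; case: ltP => // _; rewrite /= inE andbT; apply/eqP; lra.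
split.
  have /choice[g gP] : forall t, exists y, t \in T -> points y /\ F y = t.
    move=> t; have [tT|tT] := boolP (t \in T); last by exists x.
    by have [/Fsurj[y py Fy] _] := TP t tT; exists y.
  exists (map g T); last by rewrite size_map.
  split.
    rewrite map_inj_in_uniq// => s t sT tT E.
    by have [_ <-] := gP s sT; have [_ <-] := gP t tT; rewrite E.
  move=> _ /mapP[t tT ->]; have [pg Fg] := gP t tT; split=> //.
  by rewrite -Fiso// Fg; case: (TP t tT).
move=> S [uS HS]; rewrite -(size_map F); apply: uniq_leq_size.
  rewrite map_inj_in_uniq// => y z /HS[py _] /HS[pz _]; exact: Finj.
move=> _ /mapP[y /HS[py dy] ->]; have /andP[ay yb] := Fin py.
move: dy; rewrite -Fiso// -/c; case: (leP 0 (c - F y)) => h.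
  rewrite (ger0_norm h) => E; rewrite mem_cat; apply/orP; left.
  have -> : r < c - a by rewrite lt_neqAle r1/=; lra.
  by rewrite inE; apply/eqP; lra.
rewrite (ltr0_norm h) => E; rewrite mem_cat; apply/orP; right.
have -> : r < b - c by rewrite lt_neqAle r2/=; lra.
by rewrite inE; apply/eqP; lra.
Qed.

Lemma interval_mean : integral_on ET (dist_integral ET) = L ^+ 3 / 3.
Proof.
have aab : a <= a <= b by rewrite lexx.
have [p pp Fp] := Fsurj aab.
have one (x : rawpoint G) : points x -> L = b - a.
  move=> px; rewrite -integral_on1.
  have := @interval_integral x (fun=> 1) id px; rewrite /comp => ->; first by ring.
  - exact: cst_continuous.
  - by [].
have Lab := one p pp.
have D (x : rawpoint G) : points x ->
    dist_integral ET x = (dist p x ^+ 2 + (L - dist p x) ^+ 2) / 2.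
  have d2 (r : R) : is_derive r (1 : R) (fun r => r ^+ 2 / 2 : R) r.
    by apply: is_derive_eq; rewrite /GRing.scale/=; field.
  move=> px; have := @interval_integral x id _ px _ d2; rewrite /dist_integral /comp => ->.
  - rewrite -(Fiso pp px) Fp ler0_norm ?subr_le0 ?Lab; last by case/andP: (Fin px).
    by field.
  - by move=> r; exact: cvg_id.
  - by move=> s t s0 st _; nra.
pose psi r := (r ^+ 2 + (L - r) ^+ 2) / 2.
have -> : integral_on ET (dist_integral ET) = integral_on ET (psi \o dist p).
  by apply: eq_bigr => e _; apply: eq_itg => s _ /=; rewrite D//; exact: points_pt.
have dpsi (r : R) : is_derive r (1 : R) (fun r => (r ^+ 3 - (L - r) ^+ 3) / 6 : R) (psi r).
  by apply: is_derive_eq; rewrite /GRing.scale/= /psi; field.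
rewrite (@interval_integral p psi _ pp _ dpsi) ?Fp.
- by rewrite subrr Lab; field.
- rewrite /psi => r; apply: cvgMl; apply: cvgD; first exact: exprn_continuous.
  apply: (@continuous_comp _ _ _ (fun r => L - r) (fun r => r ^+ 2)); last exact: exprn_continuous.
  by apply: cvgB; [exact: cvg_cst|exact: cvg_id].
- rewrite -Lab => s t s0 st tM.
  have h1 : s ^+ 3 <= t ^+ 3 by apply: lerXn2r; rewrite ?nnegrE//; lra.
  have h2 : (L - t) ^+ 3 <= (L - s) ^+ 3 by apply: lerXn2r; rewrite ?nnegrE; lra.
  lra.
Qed.

End PathGraph.

End Levels.

(** * Doubly connected graphs and loops *)

Section Circle.
Context {R : realType} {G : metricGraph R}.
Implicit Types (x y z : rawpoint G) (e f : edge G) (s t r : R).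
Local Notation L := (total_length G).
Local Notation ET := [set: edge G]%SET.

Section Recognition.
Context (h : R) (h0 : 0 < h).
Context (antipode : forall x, points x -> exists2 x', points x' &
  forall z, points z -> dist x z + dist z x' = h).
Context (two : forall x r S, points x -> 0 < r -> at_level x r S -> (size S <= 2)%N).

Let two3 x a b c r : points x -> points a -> points b -> points c -> 0 < r ->
  dist x a = r -> dist x b = r -> dist x c = r -> a != c -> b != c -> a = b.
Proof.
move=> px pa pb pc r0 da db dc ac bc; apply/eqP; apply: contraT => ab.
have : at_level x r [:: a; b; c].
  split; first by rewrite /= !inE negb_or ab ac bc.
  by move=> z; rewrite !inE => /or3P[] /eqP->.
by move=> /(two px r0).
Qed.

(* b is a pole at distance h / 2 from the two antipodal points w and w'. *)
Let quarter b w w' := [/\ points b, points w, points w', dist b w = h / 2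
  & forall z, points z -> dist w z + dist z w' = h].

Let quarter_sym b w w' : quarter b w w' -> quarter b w' w.
Proof.
move=> [pb pw pw' bw ww']; split=> // [|z pz].
  by have := ww' b pb; rewrite (dist_sym pw pb); lra.
by rewrite (dist_sym pw' pz) (dist_sym pz pw) addrC; exact: ww'.
Qed.

Let arc_point b w w' r : quarter b w w' -> 0 <= r <= h / 2 ->
  exists m, [/\ points m, dist b m = r, dist w m = h / 2 - r & dist w' m = h / 2 + r].
Proof.
move=> [pb pw pw' bw ww'] hr; have [|m [pm bm mw]] := dist_between pb pw (t := r).
  by rewrite bw.
exists m; split=> //; first by rewrite (dist_sym pw pm) mw bw.
by have := ww' m pm; rewrite (dist_sym pw pm) (dist_sym pw' pm) mw bw; lra.
Qed.

Let two_arcs b w w' z : quarter b w w' -> points z -> dist b z <= h / 2 ->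
  dist w z = h / 2 - dist b z \/ dist w z = h / 2 + dist b z.
Proof.
move=> q pz bz; have [pb pw pw' bw ww'] := q.
have := dist_ge0 pb pz; rewrite le_eqVlt => /predU1P[d0|d0].
  by left; rewrite -(dist_eq0 pb pz (esym d0)) dist_xx// (dist_sym pw pb) bw subr0.
have hr : 0 <= dist b z <= h / 2 by rewrite ltW.
have [m [pm bm wm w'm]] := arc_point q hr.
have [m' [pm' bm' w'm' wm']] := arc_point (quarter_sym q) hr.
have mm' : m != m' by apply/eqP => E; move: wm wm'; rewrite E => ->; lra.
have [zm'|zm'] := eqVneq z m'; first by right; rewrite {1}zm'.
by left; rewrite {1}(two3 pb pz pm pm' d0 erefl bm bm' zm' mm').
Qed.

Let same_arc b w w' y z : quarter b w w' -> points y -> points z ->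
  dist b y <= dist b z -> dist b z <= h / 2 ->
  dist w y = h / 2 - dist b y -> dist w z = h / 2 - dist b z ->
  dist y z = dist b z - dist b y.
Proof.
move=> q py pz byz bz wy wz; have [pb pw pw' bw ww'] := q.
have := dist_ge0 pb py; rewrite le_eqVlt => /predU1P[d0|d0].
  by rewrite -d0 -(dist_eq0 pb py (esym d0)) subr0.
have hr : 0 <= dist b y <= h / 2 by rewrite ltW//= (le_trans byz).
have [|m [pm bm mz]] := dist_between pb pz (t := dist b y); first by rewrite ltW.
have [m' [pm' bm' w'm' wm']] := arc_point (quarter_sym q) hr.
have wm : dist w m <= h / 2 - dist b y.
  by have := dist_tri pw pz pm; rewrite (dist_sym pz pm) mz wz; lra.
have mm' : m != m' by apply/eqP => E; move: wm; rewrite E wm'; lra.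
have ym' : y != m' by apply/eqP => E; move: wy; rewrite {1}E wm'; lra.
by rewrite -mz (two3 pb py pm pm' d0 erefl bm bm' ym' mm').
Qed.

Lemma circle_recognition x0 : points x0 -> loop_graph G.
Proof.
move=> px0; have hp := h0; have [x1 po x0o] := antipode px0.
have x0_o : dist x0 x1 = h by have := x0o x1 po; rewrite (dist_xx po) addr0.
have [|w [pw x0w _]] := dist_between px0 po (t := h / 2).
  by rewrite x0_o; apply/andP; split; lra.
have [w' pw' ww'] := antipode pw.
have oz z : points z -> dist x1 z = h - dist x0 z.
  by move=> pz; have := x0o z pz; rewrite (dist_sym pz po); lra.
have q0 : quarter x0 w w' by [].
have qo : quarter x1 w w'.
  by split=> //; have := x0o w pw; rewrite (dist_sym pw po) x0w; lra.
have dle z : points z -> 0 <= dist x0 z <= h.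
  by move=> pz; rewrite dist_ge0//=; have := oz z pz; have := dist_ge0 po pz; lra.
have wz z : points z -> dist w z = `|dist x0 z - h / 2| \/
    dist w z = h - `|dist x0 z - h / 2|.
  move=> pz; have /andP[d0 dh] := dle z pz; have [zh|zh] := leP (dist x0 z) (h / 2).
    rewrite ler0_norm ?subr_le0//; have [->|->] := two_arcs q0 pz zh; [left|right]; lra.
  rewrite gtr0_norm ?subr_gt0//; have [|->|->] := two_arcs qo pz _.
  - by rewrite oz//; lra.
  - by left; rewrite oz//; lra.
  - by right; rewrite oz//; lra.
have plus z : points z -> dist w z <= h / 2 -> dist w z = `|dist x0 z - h / 2|.
  move=> pz; have /andP[d0 dh] := dle z pz; case: (wz z pz) => // ->.
  have : `|dist x0 z - h / 2| <= h / 2 by rewrite ler_norml; apply/andP; split; lra.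
  lra.
(* Points on the same half circle, named by its midpoint v. *)
have same v v' y z : quarter x0 v v' -> quarter x1 v v' -> points y -> points z ->
    dist v y = `|dist x0 y - h / 2| -> dist v z = `|dist x0 z - h / 2| ->
    dist y z = `|dist x0 y - dist x0 z|.
  move=> qx qo'; have [_ pv _ _ _] := qx.
  have H a b : points a -> points b -> dist v a = `|dist x0 a - h / 2| ->
      dist v b = `|dist x0 b - h / 2| -> dist x0 a <= dist x0 b ->
      dist a b = dist x0 b - dist x0 a.
    move=> pa pb va vb ab; have [bh|bh] := leP (dist x0 b) (h / 2).
      apply: (same_arc qx) => //; [rewrite va|rewrite vb]; rewrite ler0_norm ?opprB//; lra.
    have [ah|ah] := leP (dist x0 a) (h / 2).
      apply/eqP; rewrite eq_le; apply/andP; split.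
        have := dist_tri pa pv pb; rewrite (dist_sym pa pv) va vb.
        by rewrite ler0_norm ?subr_le0// gtr0_norm ?subr_gt0//; lra.
      by have := dist_tri px0 pa pb; lra.
    have := @same_arc x1 v v' b a qo' pb pa; rewrite !oz// (dist_sym pb pa) => ->; try lra.
      by rewrite vb gtr0_norm; lra.
    by rewrite va gtr0_norm; lra.
  move=> py pz vy vz; have [yz|zy] := leP (dist x0 y) (dist x0 z).
    by rewrite ler0_norm ?subr_le0// opprB; exact: H.
  by rewrite gtr0_norm ?subr_gt0// dist_sym//; apply: H => //; exact: ltW.
have same_plus := same w w' _ _ q0 qo.
have same_minus := same w' w _ _ (quarter_sym q0) (quarter_sym qo).
have w'E z : points z -> dist w' z = h - dist w z.
  by move=> pz; have := ww' z pz; rewrite (dist_sym pz pw'); lra.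
pose F z := if dist w z <= h / 2 then dist x0 z else 2 * h - dist x0 z.
have minus z : points z -> ~~ (dist w z <= h / 2) -> dist w' z = `|dist x0 z - h / 2|.
  move=> pz; rewrite -ltNge w'E// => zh; case: (wz z pz) => E; last by rewrite E; lra.
  have /andP[d0 dh] := dle z pz.
  have : `|dist x0 z - h / 2| <= h / 2 by rewrite ler_norml; apply/andP; split; lra.
  by rewrite -E; lra.
have mixed y z : points y -> points z -> dist w y <= h / 2 -> ~~ (dist w z <= h / 2) ->
    dist y z = circle_dist (2 * h) (F y) (F z).
  move=> py pz yw zw; have [z' pz' zz'] := antipode pz.
  have z'w : dist w z' <= h / 2.
    by have := zz' w pw; rewrite (dist_sym pz pw); move: zw; rewrite -ltNge; lra.
  have x0z' : dist x0 z' = h - dist x0 z by have := zz' x0 px0; rewrite (dist_sym pz px0); lra.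
  have := same_plus y z' py pz' (plus y py yw) (plus z' pz' z'w).
  have := zz' y py; rewrite (dist_sym pz py) x0z' => h1 h2.
  have -> : dist y z = h - `|dist x0 y - (h - dist x0 z)| by lra.
  rewrite /F yw (negbTE zw) /circle_dist.
  have /andP[? ?] := dle y py; have /andP[? ?] := dle z pz.
  rewrite (@ler0_norm _ (dist x0 y - (2 * h - _))); last lra.
  by case: (leP 0 (dist x0 y - (h - dist x0 z))) => ?;
    [rewrite ger0_norm//|rewrite ltr0_norm//]; case: leP; lra.
have csym c s t : circle_dist c s t = circle_dist c t s by rewrite /circle_dist distrC.
have iso y z : points y -> points z -> circle_dist (2 * h) (F y) (F z) = dist y z.
  move=> py pz; have [yw|yw] := boolP (dist w y <= h / 2);
    have [zw|zw] := boolP (dist w z <= h / 2).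
  - rewrite (same_plus y z py pz (plus y py yw) (plus z pz zw)) /F yw zw /circle_dist.
    apply/min_idPl; have /andP[? ?] := dle y py; have /andP[? ?] := dle z pz.
    have : `|dist x0 y - dist x0 z| <= h by rewrite ler_norml; apply/andP; split; lra.
    lra.
  - by rewrite mixed.
  - by rewrite csym -mixed// dist_sym.
  - rewrite (same_minus y z py pz (minus y py yw) (minus z pz zw)).
    rewrite /F (negbTE yw) (negbTE zw) /circle_dist.
    rewrite (_ : 2 * h - dist x0 y - (2 * h - dist x0 z) = - (dist x0 y - dist x0 z)); last by ring.
    rewrite normrN; apply/min_idPl; have /andP[? ?] := dle y py; have /andP[? ?] := dle z pz.
    have : `|dist x0 y - dist x0 z| <= h by rewrite ler_norml; apply/andP; split; lra.
    lra.
exists (2 * h); split; first by rewrite mulr_gt0.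
exists F; split=> //; split.
- move=> z pz /=; rewrite in_itv/= /F; have /andP[d0 dh] := dle z pz.
  case: ifPn => zw; apply/andP; split; try lra.
  suff : dist x0 z != 0 by rewrite neq_lt ltNge d0/=; lra.
  apply/eqP => /(dist_eq0 px0 pz) E; move: zw; rewrite -E (dist_sym pw px0) x0w lexx//.
- move=> y z /set_mem py /set_mem pz E; apply: dist_eq0 => //; rewrite -iso// E /circle_dist.
  by rewrite subrr normr0 subr0; apply/min_idPl; rewrite mulr_ge0// ltW.
move=> t /=; rewrite in_itv/= => /andP[t0 th].
have [t1|t1] := leP t h.
  have [t2|t2] := leP t (h / 2).
    have [|m [pm x0m wm _]] := arc_point q0 (r := t); first by rewrite t0.
    by exists m => //; rewrite /F wm x0m ifT//; lra.
  have [|m [pm om wm _]] := arc_point qo (r := h - t); first by apply/andP; split; lra.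
  by exists m => //; move: om; rewrite oz// /F wm ifT; lra.
have [t2|t2] := leP (2 * h - t) (h / 2).
  have [|m [pm x0m _ wm]] := arc_point (quarter_sym q0) (r := 2 * h - t).
    by apply/andP; split; lra.
  by exists m => //; rewrite /F wm x0m ifF; [lra|apply/negbTE; rewrite -ltNge; lra].
have [|m [pm om _ wm]] := arc_point (quarter_sym qo) (r := t - h); first by apply/andP; split; lra.
by exists m => //; move: om; rewrite oz// /F wm ifF; [lra|apply/negbTE; rewrite -ltNge; lra].
Qed.

End Recognition.

Context (L0 : 0 < L) (dc : doubly_connected G).

Lemma dist_integral_le_quarter x : points x -> dist_integral ET x <= L ^+ 2 / 4.
Proof.
move=> px; have [M [HM HMy]] := eccentricity L0 px.
have := sqr_ge0 (L - 2 * M); have := dist_integral_le_ecc L0 px HM (covers2 px dc HMy); nra.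
Qed.

Lemma doubly_connected_bound : integral_on ET (dist_integral ET) <= L ^+ 3 / 4.
Proof.
have -> : L ^+ 3 / 4 = integral_on ET (fun _ : rawpoint G => L ^+ 2 / 4).
  by rewrite integral_on_cst -total_lengthE; ring.
apply: le_integral_on; [exact: dist_integral_continuous|exact: gcontinuous_cst|].
exact: dist_integral_le_quarter.
Qed.

Lemma doubly_connected_bound_loop :
  L ^+ 3 / 4 <= integral_on ET (dist_integral ET) -> loop_graph G.
Proof.
move=> Wge; have DE x : points x -> dist_integral ET x = L ^+ 2 / 4.
  move=> px; have [e [t [_ ->]]] := points_on_edge L0 px.
  apply: (@integral_on_eq _ G ET (dist_integral ET) (fun=> L ^+ 2 / 4)).
  - exact: dist_integral_continuous.
  - exact: gcontinuous_cst.
  - exact: dist_integral_le_quarter.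
  - by rewrite integral_on_cst -total_lengthE; apply: le_trans Wge; nra.
  - by rewrite inE.
have ecc x : points x -> (forall z, points z -> dist x z <= L / 2) /\
    exists2 y, points y & dist x y = L / 2.
  move=> px; have [M [HM HMy]] := eccentricity L0 px.
  suff <- : M = L / 2 by [].
  have := dist_integral_le_ecc L0 px HM (covers2 px dc HMy); rewrite DE// => le.
  by apply/eqP; rewrite -subr_eq0 -sqrf_eq0 eq_le sqr_ge0 andbT; nra.
have /card_gt0P[e0 _] := card_edge_gt0 L0.
apply: (@circle_recognition (L / 2) _ _ _ (pt e0 0)); [exact: divr_gt0| | |exact: points_pt].
- move=> x px; have [HM [y py dy]] := ecc x px; exists y => // z pz.
  rewrite (dist_sym pz py); have [e [t [_ ->]]] := points_on_edge L0 pz.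
  have cxy : gcontinuous (fun z => dist x z + dist y z).
    by apply: gcontinuousD; exact: dist_continuous.
  apply/esym; apply: (@integral_on_eq _ G ET (fun=> L / 2)
    (fun z => dist x z + dist y z) _ _ _ _ e t) => //.
  + exact: gcontinuous_cst.
  + by move=> u pu; rewrite -dy (dist_sym py pu); exact: dist_tri.
  + rewrite integral_onD; [|exact: dist_continuous|exact: dist_continuous].
    rewrite -/(dist_integral ET x) -/(dist_integral ET y) !DE// integral_on_cst -total_lengthE.
    by nra.
- move=> x r S px r0; have [HM HMy] := ecc x px.
  apply: (level_size_le L0 px HM (covers2 px dc HMy)) => //.
  by rewrite DE//; nra.
Qed.

Section Loop.
Context (c : R) (F : rawpoint G -> R).
Context (Fbij : set_bij (@points R G) `[0, c[ F).
Context (Fiso : forall y z, points y -> points z -> circle_dist c (F y) (F z) = dist y z).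

Let loop_levels x r S : points x -> 0 < r -> at_level x r S -> (size S <= 2)%N.
Proof.
move=> px r0 [uS HS]; have Fin y : points y -> 0 <= F y < c.
  by case: Fbij => h _ _ /h /=; rewrite in_itv.
pose p := if F x + r < c then F x + r else F x + r - c.
pose q := if 0 <= F x - r then F x - r else F x - r + c.
rewrite -(size_map F); apply: (@uniq_leq_size _ _ [:: p; q]).
  rewrite map_inj_in_uniq// => y z /HS[py _] /HS[pz _] E.
  by case: Fbij => _ + _; apply => //; exact: mem_set.
move=> _ /mapP[y /HS[py dy] ->]; move: dy; rewrite -Fiso// /circle_dist => E.
have /andP[x1 x2] := Fin x px; have /andP[y1 y2] := Fin y py.
rewrite !inE /p /q; apply/orP; move: E.
have [h|h] := leP 0 (F x - F y).
  rewrite (ger0_norm h); case: (leP (F x - F y) (c - (F x - F y))) => _ E.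
    by right; rewrite ifT; [apply/eqP; lra|lra].
  by left; rewrite ifF; [apply/eqP; lra|apply/negbTE; rewrite -leNgt; lra].
rewrite (ltr0_norm h); case: (leP (- (F x - F y)) (c - (- (F x - F y)))) => _ E.
  by left; rewrite ifT; [apply/eqP; lra|lra].
by right; rewrite ifF; [apply/eqP; lra|apply/negbTE; rewrite -ltNge; lra].
Qed.

Lemma loop_mean : integral_on ET (dist_integral ET) = L ^+ 3 / 4.
Proof.
suff D x : points x -> dist_integral ET x = L ^+ 2 / 4.
  rewrite (_ : integral_on _ _ = integral_on ET (fun _ : rawpoint G => L ^+ 2 / 4)).
    by rewrite integral_on_cst -total_lengthE; field.
  by apply: eq_bigr => e _; apply: eq_itg => s _; apply: D; exact: points_pt.
move=> px; have [M [HM HMy]] := eccentricity L0 px.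
have [Y HY] := covers2 px dc HMy.
have M0 : 0 <= M by rewrite -(dist_xx px) HM.
have eq (psi Psi : R -> R) : continuous psi -> (forall r : R, is_derive r (1 : R) Psi (psi r)) ->
    (forall s t, 0 <= s -> s <= t -> t <= M -> Psi s <= Psi t) ->
    integral_on ET (psi \o dist x) = 2 * (Psi M - Psi 0).
  move=> cpsi dPsi mPsi.
  rewrite (@integral_dist_eq _ _ L0 x [:: (0, M); (0, M)] Y M psi Psi)//.
  - by rewrite /increments !big_cons big_nil /=; ring.
  - by move=> p; rewrite !inE => /orP[]/eqP->; rewrite /= lexx.
  - move=> r hr rY; rewrite /= /inside/= hr /=; split; first exact: HY.
    by move=> S; apply: loop_levels => //; case/andP: hr.
have LM : L = 2 * M.
  rewrite -(@integral_on1 _ G); have := eq (fun=> 1) id; rewrite /comp => ->.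
  - by rewrite subr0.
  - exact: cst_continuous.
  - by [].
have d2 (r : R) : is_derive r (1 : R) (fun r => r ^+ 2 / 2 : R) r.
  by apply: is_derive_eq; rewrite /GRing.scale/=; field.
have := eq id _ _ d2; rewrite /comp /dist_integral => ->.
- by rewrite LM; field.
- by move=> r; exact: cvg_id.
- by move=> s t s0 st _; nra.
Qed.

End Loop.

End Circle.

Theorem theorem3p2 (R : realType) (G : metricGraph R) (L : R) (E : nat)
    (L_def : total_length G = L) (L_gt0 : 0 < L) (E_def : #|edge G| = E) :
  [/\ (2 * E%:R - 1) / (4 * E%:R ^+ 2) * L <= mean_distance G <= L / 3,
      mean_distance G = (2 * E%:R - 1) / (4 * E%:R ^+ 2) * L <->
        flower_graph G /\ equilateral G,
      mean_distance G = L / 3 <-> path_graph G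
    & doubly_connected G ->
        mean_distance G <= L / 4 /\ (mean_distance G = L / 4 <-> loop_graph G)].
Proof.
have L0 : 0 < total_length G by rewrite L_def.
have L20 : 0 < total_length G ^+ 2 by rewrite exprn_gt0.
rewrite mean_distanceE -E_def -L_def; set W := integral_on _ _.
have leW k : (W / total_length G ^+ 2 <= k * total_length G) = (W <= k * total_length G ^+ 3).
  by rewrite ler_pdivrMr// -mulrA -exprS.
have geW k : (k * total_length G <= W / total_length G ^+ 2) = (k * total_length G ^+ 3 <= W).
  by rewrite ler_pdivlMr// -mulrA -exprS.
have eqW k : W / total_length G ^+ 2 = k * total_length G <-> W = k * total_length G ^+ 3.
  have E1 : (W / total_length G ^+ 2 == k * total_length G) = (W == k * total_length G ^+ 3).
    by rewrite !eq_le leW geW.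
  by split=> /eqP; [rewrite E1|rewrite -E1] => /eqP.
have [W3 W3eq] := dist_integral_upper_bound L0; rewrite -/W in W3 W3eq.
rewrite ![total_length G / _]mulrC; split.
- rewrite geW leW dist_integral_lower_bound//=; lra.
- by rewrite eqW; exact: dist_integral_lower_bound_eq.
- rewrite eqW; split=> [WE|[a [b [ab [F [Fbij Fiso]]]]]].
    have [|w Dw] := W3eq; first by rewrite WE mulrC.
    exact: (@longest_path_graph _ _ L0 (inl w)).
  by rewrite /W (interval_mean L0 ab Fbij Fiso) mulrC.
- move=> dc; rewrite leW eqW mulrC.
  split; first by have := doubly_connected_bound L0 dc.
  split=> [WE|[c [_ [F [Fbij Fiso]]]]].
    by apply: doubly_connected_bound_loop => //; rewrite -/W WE mulrC.
  by rewrite /W (loop_mean L0 dc Fbij Fiso) mulrC.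
Qed.
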